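(* Suppose that the following (mutually equivalent) conditions hold: $\{\hat w_h\in W_h: a(\hat w_h,\hat v_h)=0\ \forall\hat v_h\in W_h\}=\operatorname{span}\{1\}$; the only $\hat v_h\in W_h$ with $\hat v_h|_\Gamma=0$ is $\hat v_h=0$; $\Gamma$ is not contained in the zero level set of any non-zero function in $W_h$; $\dim(W_h)=\dim(V_h)$. Then: (i) For every real constant $c>0$ and every $f\in L^2(\Gamma)$ there exists a unique $\hat u_h\in W_h$ such that $a(\hat u_h,\hat v_h)+(c\hat u_h,\hat v_h)_\Gamma=(f,\hat v_h)_\Gamma$ for all $\hat v_h\in W_h$. (ii) The following two problems have the same eigenvalues: find $(\lambda_h,u_h)\in\mathbb{R}\times V_h$ with $\|u_h\|_{L^2(\Gamma)}=1$ such that $a(u_h,v_h)=\lambda_h(u_h,v_h)_\Gamma$ for all $v_h\in V_h$; and find $(\lambda_h,\hat u_h)\in\mathbb{R}\times W_h$ with $\|\hat u_h\|_{L^2(\omega_h)}=1$ such that $a(\hat u_h,\hat v_h)=\lambda_h(\hat u_h,\hat v_h)_\Gamma$ for all $\hat v_h\in W_h$.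
   Context: Setting: $\Gamma$ is a closed (compact, without boundary), connected, smooth surface contained in a bounded domain $\Omega\subset\mathbb{R}^3$, and $\mathcal{T}_h$ is a shape-regular tetrahedral partition of $\Omega$. For $T\in\mathcal{T}_h$ put $F_T=T\cap\Gamma$, and let $\mathcal{T}_h^\Gamma=\{T\in\mathcal{T}_h: \operatorname{meas}_2(F_T)\ne 0\}$ (if $F_T$ lies on the common face of two neighbouring tetrahedra, only one of them is kept in $\mathcal{T}_h^\Gamma$). Let $\omega_h=\bigcup_{T\in\mathcal{T}_h^\Gamma}T$. For a fixed integer $k\ge1$, $W_h=\{\hat v_h\in C(\omega_h): \hat v_h|_T\in P_k(T)\ \forall T\in\mathcal{T}_h^\Gamma\}$, where $P_k(T)$ is the space of polynomials of degree at most $k$ on $T$, and $V_h=\{\hat v_h|_\Gamma:\hat v_h\in W_h\}$ is the space of traces on $\Gamma$. Bilinear forms: $a(u,v)=\int_\Gamma\nabla_\Gamma u\cdot\nabla_\Gamma v\,\mathrm{d}s$ with $\nabla_\Gamma$ the surface gradient, and $(u,v)_\Gamma=\int_\Gamma uv\,\mathrm{d}s$; applied to functions in $W_h$ they are evaluated on the traces on $\Gamma$. *)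

(* Defs.v *)
From HB Require Import structures.
From mathcomp Require Import all_boot all_order all_algebra.
From mathcomp Require Import all_classical all_reals all_analysis.
From mathcomp Require mpoly.
(* the notations of mpoly clash with those of analysis *)
Import (canonicals, coercions) mpoly.

Set Implicit Arguments.
Unset Strict Implicit.
Unset Printing Implicit Defensive.

Import Order.TTheory GRing.Theory Num.Theory.
Import numFieldNormedType.Exports.

Local Open Scope classical_set_scope.
Local Open Scope ring_scope.

(* Products carry the product topology and the product sigma-algebra (hence the
   Borel one), but the *max* norm: Euclidean quantities below go through [dot]. *)
Notation R3 R := (R * R * R)%type.
Notation R2 R := (R * R)%type.

Section Euclidean.
Context {R : realType}.
Implicit Types (x y : R3 R).

Definition coord x (i : 'I_3) : R := [:: x.1.1; x.1.2; x.2]`_i.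

Definition dot x y : R := \sum_(i < 3) coord x i * coord y i.

Definition edist x y : R := Num.sqrt (dot (x - y) (x - y)).

(* lebesgue_measure lives on [measurableTypeR R], whose carrier is R and whose
   measurable sets are the Borel ones. *)
Definition lebesgue2 :
    {measure set (measurableTypeR R * measurableTypeR R) -> \bar R} :=
  (@lebesgue_measure R \x @lebesgue_measure R)%E.

Definition lebesgue3 :
    {measure set (measurableTypeR R * measurableTypeR R * measurableTypeR R)
       -> \bar R} :=
  (@lebesgue_measure R \x @lebesgue_measure R \x @lebesgue_measure R)%E.

Definition domain (Omega : set (R3 R)) :=
  [/\ open Omega, connected Omega & Omega !=set0].

End Euclidean.

Section Smooth.
Context {R : realType} {V W : normedModType R}.

Fixpoint iter_derive (vs : seq V) (f : V -> W) : V -> W :=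
  if vs is v :: vs' then fun x => 'D_v (iter_derive vs' f) x else f.

Definition smooth_on (U : set V) (f : V -> W) :=
  forall vs x, U x ->
    {for x, continuous (iter_derive vs f)} /\
    forall v, derivable (iter_derive vs f) x v.

End Smooth.

Section Surface.
Context {R : realType}.
Implicit Types (Gamma : set (R3 R)) (U : set (R2 R)) (psi : R2 R -> R3 R).

(* The area density |d_1 psi x d_2 psi|, as the root of the Gram determinant. *)
Definition area_density psi (q : R2 R) : R :=
  let a := 'D_((1, 0) : R2 R) psi q in
  let b := 'D_((0, 1) : R2 R) psi q in
  Num.sqrt (dot a a * dot b b - dot a b ^+ 2).

(* A regular parametrization of an open piece of Gamma: a smooth immersion
   which is a homeomorphism onto a relatively open subset of Gamma (the last
   clause with O := setT says that the image is relatively open). *)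
Definition local_param Gamma U psi :=
  [/\ open U, smooth_on U psi, set_inj U psi,
      (forall q, U q -> 0 < area_density psi q) &
      forall O, open O ->
        exists2 V, open V & psi @` (U `&` O) = Gamma `&` V].

Definition smooth_surface Gamma :=
  forall x, Gamma x -> exists U psi, local_param Gamma U psi /\ (psi @` U) x.

Definition closed_connected_smooth_surface Gamma :=
  [/\ compact Gamma, connected Gamma, Gamma !=set0 & smooth_surface Gamma].

(* The surface measure ds (and meas_2) of Gamma, as a Borel measure on R^3
   concentrated on Gamma.  It is determined by the area formula in local
   parametrizations, since countably many of them cover Gamma. *)
Definition surface_measure Gamma (sigma : {measure set (R3 R) -> \bar R}) :=
  sigma (~` Gamma) = 0%E /\
  forall U psi, local_param Gamma U psi ->
    forall A : set (R3 R), measurable A ->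
      sigma (A `&` psi @` U) =
      (\int[lebesgue2]_(q in U `&` psi @^-1` A)
         (area_density psi q)%:E)%E.

(* g is the surface gradient at x of (the restriction to Gamma of) u: it is
   tangent to Gamma at x = psi q, and <g, w> = du(w) for every tangent vector
   w = d psi_q(v).  As psi maps U into Gamma, only u|_Gamma matters. *)
Definition is_surface_grad Gamma (u : R3 R -> R) (x g : R3 R) :=
  exists U psi q,
    [/\ local_param Gamma U psi, U q, psi q = x,
        (exists v : R2 R, g = 'D_v psi q) &
        differentiable (u \o psi) q /\
        forall v : R2 R, 'D_v (u \o psi) q = dot g ('D_v psi q)].

(* The value is 0 where u|_Gamma is not differentiable. *)
Definition surface_grad Gamma (u : R3 R -> R) (x : R3 R) : R3 R :=
  xget 0 [set g | is_surface_grad Gamma u x g].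

Definition bilin_a Gamma (sigma : {measure set (R3 R) -> \bar R})
    (u v : R3 R -> R) : R :=
  \int[sigma]_(x in Gamma) dot (surface_grad Gamma u x) (surface_grad Gamma v x).

Definition bilin_l2 Gamma (sigma : {measure set (R3 R) -> \bar R})
    (u v : R3 R -> R) : R :=
  \int[sigma]_(x in Gamma) (u x * v x).

End Surface.

Section Mesh.
Context {R : realType}.

Definition tetrahedron (P : 'I_4 -> R3 R) : set (R3 R) :=
  [set x | exists l : 'I_4 -> R,
     [/\ forall i, 0 <= l i, \sum_i l i = 1 & x = \sum_i l i *: P i]].

Definition affinely_independent (P : 'I_4 -> R3 R) :=
  forall l : 'I_4 -> R,
    \sum_i l i = 0 -> \sum_i l i *: P i = 0 -> forall i, l i = 0.

(* A mesh with N elements is given by the four vertices of each element. *)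
Definition tetrahedral_partition (Omega : set (R3 R)) N
    (T : 'I_N -> 'I_4 -> R3 R) :=
  [/\ forall i, affinely_independent (T i),
      \bigcup_(i in setT) tetrahedron (T i) = closure Omega &
      forall i j, i != j ->
        interior (tetrahedron (T i)) `&` interior (tetrahedron (T j)) = set0].

(* Each element K contains a ball of radius r with diam K <= kappa * r. *)
Definition shape_regular (kappa : R) N (T : 'I_N -> 'I_4 -> R3 R) :=
  forall i, exists x r,
    [/\ 0 < r,
        (forall y, edist x y <= r -> tetrahedron (T i) y) &
        forall y z, tetrahedron (T i) y -> tetrahedron (T i) z ->
          edist y z <= kappa * r].

Definition cut (Gamma : set (R3 R)) N (T : 'I_N -> 'I_4 -> R3 R) (i : 'I_N) :=
  tetrahedron (T i) `&` Gamma.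

(* S indexes an admissible choice of the elements cut by Gamma.  An element K
   with meas_2(F_K) != 0 is left out only if F_K lies in a kept neighbour K',
   i.e. on the common face of K and K'; and in that case K and K' are not both
   kept.  When F_K = F_K' either of the two may be the one that is kept. *)
Definition cut_mesh (Gamma : set (R3 R))
    (sigma : {measure set (R3 R) -> \bar R}) N
    (T : 'I_N -> 'I_4 -> R3 R) (S : {set 'I_N}) :=
  [/\ forall i, i \in S -> sigma (cut Gamma T i) <> 0%E,
      (forall i, sigma (cut Gamma T i) <> 0%E -> i \notin S ->
         exists j, [/\ j \in S, j != i &
           cut Gamma T i `<=` tetrahedron (T i) `&` tetrahedron (T j)]) &
      forall i j, i \in S -> j \in S -> i != j ->
        ~ (cut Gamma T i `<=` tetrahedron (T i) `&` tetrahedron (T j))].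

Definition omega_h N (T : 'I_N -> 'I_4 -> R3 R) (S : {set 'I_N}) : set (R3 R) :=
  \bigcup_(i in [set j | j \in S]) tetrahedron (T i).

End Mesh.

Section FiniteElements.
Context {R : realType}.

(* [mpoly.msize p <= k.+1] means that p has total degree at most k. *)
Definition polynomial_on (k : nat) (A : set (R3 R)) (v : R3 R -> R) :=
  exists2 p : mpoly.mpoly 3 R, (mpoly.msize p <= k.+1)%N &
    forall x, A x -> v x = mpoly.meval (coord x) p.

(* Functions on omega_h (resp. on Gamma) are represented by their extension by
   zero to R^3, so that they are equal iff their extensions are, and W_h and
   V_h are linear subspaces of R^3 -> R. *)
Definition W_h (k : nat) N (T : 'I_N -> 'I_4 -> R3 R) (S : {set 'I_N}) :
    set (R3 R -> R) :=
  [set v | [/\ {within omega_h T S, continuous v},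
     (forall i, i \in S -> polynomial_on k (tetrahedron (T i)) v) &
     forall x, ~ omega_h T S x -> v x = 0]].

Definition V_h (Gamma : set (R3 R)) (k : nat) N (T : 'I_N -> 'I_4 -> R3 R)
    (S : {set 'I_N}) : set (R3 R -> R) :=
  [set v \_ Gamma | v in W_h k T S].

Definition has_dim (X : set (R3 R -> R)) (n : nat) :=
  exists e : 'I_n -> R3 R -> R,
    (forall l : 'I_n -> R, \sum_i l i *: e i = 0 -> forall i, l i = 0) /\
    X = [set v | exists l : 'I_n -> R, v = \sum_i l i *: e i].

End FiniteElements.

(* Main.v *)
(** As soon as a function of W_h that vanishes on Gamma is zero, the form
    a + c (.,.)_Gamma is positive definite on the finite-dimensional space W_h,
    which gives (i), and the restriction W_h -> V_h is a bijection that preserves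
    both forms, so eigenfunctions correspond up to normalization, which gives (ii).
    Each of the four conditions implies this injectivity; for the third one, one
    needs that Gamma is contained in omega_h, which holds because the rest of Gamma
    is relatively open and null while the surface measure charges every nonempty
    relatively open set.

    The delicate point is the bilinearity of a, since functions of W_h are only
    continuous and piecewise polynomial.  Where two pieces overlap they agree, and
    the points of Gamma where two smooth functions agree but have different
    surface gradients form a null set: in a chart, their difference g vanishes
    there with dg <> 0, and the zeros of g with a nonzero partial derivative are
    isolated on the lines in that direction.  Off this null set all pieces through
    a point have the same gradient, so the surface gradient exists. *)

Require Import Defs.
From HB Require Import structures.
From mathcomp Require Import all_boot all_order all_algebra.
From mathcomp Require Import all_classical all_reals all_analysis.
From mathcomp Require Import measurable_realfun ring lra.
From mathcomp Require mpoly.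
Import (canonicals, coercions) mpoly.

Set Implicit Arguments.
Unset Strict Implicit.
Unset Printing Implicit Defensive.

Import Order.TTheory GRing.Theory Num.Theory.
Import numFieldNormedType.Exports.

Local Open Scope classical_set_scope.
Local Open Scope ring_scope.

(** * Borel sets and Lebesgue measure in the plane and in space *)

(** [surface_grad] is obtained by a choice among charts and is 0 where the trace is not
    differentiable, so it is neither chart-free nor additive by construction. Transition maps
    between charts are avoided: a gradient in one chart is turned into an expansion of the function
    along Gamma in the ambient distance ([first_order]), which is then read in any other chart. The
    first passage needs a Lipschitz bound for the inverse of a chart, the second one for the chart
    itself; the former comes from the positive Gram determinant. Additivity is established off a
    null set only. This set is removed from the domain of integration, which is harmless even for
    integrands not known to be measurable, because the integral of a nonnegative function is a
    supremum over simple functions. In (ii) an eigenfunction has to be rescaled to norm 1 in the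
    other norm, so it must be nonzero there: in omega_h because the elements have interior points,
    on Gamma because of injectivity. *)

Definition nbhs_base (T : topologicalType) (I : Type) (B : I -> set T) :=
  forall x A, nbhs x A -> exists2 i, B i x & B i `<=` A.

Lemma nbhs_baseX (T1 T2 : topologicalType) (I1 I2 : Type)
    (B1 : I1 -> set T1) (B2 : I2 -> set T2) :
  nbhs_base B1 -> nbhs_base B2 ->
  nbhs_base (fun i : I1 * I2 => B1 i.1 `*` B2 i.2).
Proof.
move=> h1 h2 [x y] A [[A1 A2] /= [nA1 nA2] sA].
have [i Bi iA] := h1 _ _ nA1; have [j Bj jA] := h2 _ _ nA2.
by exists (i, j) => // -[a b] /= [ha hb]; apply: sA; split; [exact: iA|exact: jA].
Qed.

(** The union ranges over indices, so a countable index type makes it a countable union; this is how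
    open sets become measurable for the product sigma-algebra. *)
Lemma open_base (T : topologicalType) I (B : I -> set T) (O : set T) :
  nbhs_base B -> open O -> O = \bigcup_(i in [set i | B i `<=` O]) B i.
Proof.
move=> hB oO; apply/seteqP; split=> x.
  by move=> Ox; have [i Bi iO] := hB _ _ (open_nbhs_nbhs (conj oO Ox)); exists i.
by move=> [i iO] /iO.
Qed.

Section base.
Context {R : realType}.

Definition rat_itv (i : rat * rat) : set R := `]ratr i.1, ratr i.2[%classic.

Lemma rat_itv_base : nbhs_base rat_itv.
Proof.
move=> x A /nbhs_ballP[e /= e0 xA].
have [a] : exists q : rat, ratr q \in `]x - e, x[ by apply: rat_in_itvoo; rewrite ltrBlDr ltrDl.
have [b] : exists q : rat, ratr q \in `]x, x + e[ by apply: rat_in_itvoo; rewrite ltrDl.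
rewrite !in_itv/= => /andP[b1 b2] /andP[a1 a2].
exists (a, b); rewrite /rat_itv/= ?in_itv/= ?a2 ?b1// => y/=; rewrite in_itv/= => /andP[y1 y2].
by apply: xA; rewrite /ball/= ltr_distl; apply/andP; split; lra.
Qed.

Lemma measurable_rat_itv i : measurable (rat_itv i).
Proof. exact: measurable_itv. Qed.

Definition base2 := fun i : (rat * rat) * (rat * rat) => rat_itv i.1 `*` rat_itv i.2.
Lemma open_measurable2 (O : set (R2 R)) : open O -> measurable O.
Proof.
move=> oO; rewrite (open_base (nbhs_baseX rat_itv_base rat_itv_base) oO).
rewrite bigcup_mkcond; apply: countable_bigcupT_measurable => [|i]; first exact: countableP.
by case: ifPn => // _; apply: measurableX; exact: measurable_rat_itv.
Qed.

Lemma open_measurable3 (O : set (R3 R)) : open O -> measurable O.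
Proof.
move=> oO.
rewrite (open_base (nbhs_baseX (nbhs_baseX rat_itv_base rat_itv_base) rat_itv_base) oO).
rewrite bigcup_mkcond; apply: countable_bigcupT_measurable => [|i]; first exact: countableP.
by case: ifPn => // _; do 2?apply: measurableX; exact: measurable_rat_itv.
Qed.

Lemma closed_measurable3 (F : set (R3 R)) : closed F -> measurable F.
Proof. by move=> /closed_openC/open_measurable3/measurableC; rewrite setCK. Qed.

Lemma within_preimage_open (T U : topologicalType) (A : set T) (f : T -> U) (O : set U) :
  {within A, continuous f} -> open O ->
  exists2 V, open V & A `&` f @^-1` O = A `&` V.
Proof.
move=> /continuousP cf oO; have /open_subspaceP[V oV VA] := cf _ oO.
by exists V => //; rewrite setIC -VA setIC.
Qed.

Lemma within_measurable3 (A : set (R3 R)) (f : R3 R -> R) :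
  measurable A -> {within A, continuous f} -> measurable_fun A f.
Proof.
move=> mA cf; apply: (measurability _ (measurable_realfun.RGenOpens.measurableE R)).
move=> _ [_ [a [b ->]] <-].
have oab : open `]a, b[%classic by exact: interval_open.
have [V oV ->] := within_preimage_open cf oab.
by apply: measurableI => //; exact: open_measurable3.
Qed.

Lemma within_measurable2 (A : set (R2 R)) (f : R2 R -> R) :
  measurable A -> {within A, continuous f} -> measurable_fun A f.
Proof.
move=> mA cf; apply: (measurability _ (measurable_realfun.RGenOpens.measurableE R)).
move=> _ [_ [a [b ->]] <-].
have oab : open `]a, b[%classic by exact: interval_open.
have [V oV ->] := within_preimage_open cf oab.
by apply: measurableI => //; exact: open_measurable2.
Qed.

Lemma rat_itv_gt0 i x : rat_itv i x -> (0 < (@lebesgue_measure R) (rat_itv i))%E.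
Proof.
rewrite /rat_itv/= in_itv/= => /andP[h1 h2].
rewrite lebesgue_measure_itv/= lte_fin (lt_trans h1 h2) -EFinD lte_fin.
by rewrite subr_gt0 (lt_trans h1 h2).
Qed.

Lemma lebesgue2X i j : lebesgue2 (rat_itv i `*` rat_itv j) =
  (@lebesgue_measure R (rat_itv i) * @lebesgue_measure R (rat_itv j))%E.
Proof. by apply: product_measure1E; exact: measurable_rat_itv. Qed.

Lemma lebesgue3X i j k : lebesgue3 ((rat_itv i `*` rat_itv j) `*` rat_itv k) =
  (@lebesgue_measure R (rat_itv i) * @lebesgue_measure R (rat_itv j) *
    @lebesgue_measure R (rat_itv k))%E.
Proof.
rewrite -lebesgue2X; apply: product_measure1E; last exact: measurable_rat_itv.
by apply: measurableX; exact: measurable_rat_itv.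
Qed.

Lemma lebesgue2_open_gt0 (O : set (R2 R)) : open O -> O !=set0 -> (0 < lebesgue2 O)%E.
Proof.
move=> oO [x Ox].
have [[i j] [/= ix jx] ijO] :=
  nbhs_baseX rat_itv_base rat_itv_base (open_nbhs_nbhs (conj oO Ox)).
apply: (@lt_le_trans _ _ (lebesgue2 (rat_itv i `*` rat_itv j))).
  rewrite lebesgue2X.
  by rewrite mule_gt0// (rat_itv_gt0 ix, rat_itv_gt0 jx).
apply: le_measure => //; rewrite inE; last exact: open_measurable2.
by apply: measurableX; exact: measurable_rat_itv.
Qed.

Lemma lebesgue3_open_gt0 (O : set (R3 R)) : open O -> O !=set0 -> (0 < lebesgue3 O)%E.
Proof.
move=> oO [x Ox].
have [[[i j] k] [/= [/= ix jx] kx] ijO] := nbhs_baseX (nbhs_baseX rat_itv_base rat_itv_base)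
  rat_itv_base (open_nbhs_nbhs (conj oO Ox)).
apply: (@lt_le_trans _ _ (lebesgue3 ((rat_itv i `*` rat_itv j) `*` rat_itv k))).
  rewrite lebesgue3X.
  by rewrite !mule_gt0// (rat_itv_gt0 ix, rat_itv_gt0 jx, rat_itv_gt0 kx).
apply: le_measure => //; rewrite inE; last exact: open_measurable3.
by do 2?apply: measurableX; exact: measurable_rat_itv.
Qed.

End base.

(** * Differential calculus *)

Section differentiability.
Context {R : realType}.

Lemma differentiable_le (V W : normedModType R) (f : V -> W) x (e : R) :
  differentiable f x -> 0 < e ->
  \forall y \near x, `|f y - f x - 'd f x (y - x)| <= e * `|y - x|.
Proof.
move=> /diff_locally /eqaddoP h e0; have := h e e0.
rewrite (near_shift 0 x) subr0; apply: filterS => y /=.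
by rewrite !fctE/= addrK opprD addrA.
Qed.

Lemma le_differentiable (V W : normedModType R) (f : V -> W) x (df : {linear V -> W}) :
  continuous df ->
  (forall e : R, 0 < e ->
    \forall y \near x, `|f y - f x - df (y - x)| <= e * `|y - x|) ->
  differentiable f x /\ 'd f x = df :> (V -> W).
Proof.
move=> cdf h.
have dfE : f \o shift x = cst (f x) + df +o_ 0 id.
  apply/eqaddoP => e e0; have := h e e0.
  rewrite (near_shift 0 x) subr0; apply: filterS => y /=.
  by rewrite !fctE/= addrK opprD addrA.
have E := diff_unique cdf dfE.
split=> //; apply/diff_locallyP; split; first by rewrite E.
by rewrite {1}dfE E.
Qed.

Lemma is_derive_lin (V W W' : normedModType R) (L : {linear W -> W'}) (f : V -> W) x v :
  continuous L -> derivable f x v -> is_derive x v (L \o f) (L ('D_v f x)).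
Proof.
move=> cL df.
have h : h^-1 *: ((L \o f \o shift x) (h *: v) - (L \o f) x) @[h --> 0^'] --> L ('D_v f x).
  under eq_fun do rewrite /= -linearB -linearZ.
  exact: (cvg_comp _ _ df (cL _)).
by split; [apply/cvg_ex; eexists; exact: h|exact: cvg_lim].
Qed.

(** By the mean value theorem the chord has slope [dg t] at some intermediate t, which is within e
    of c. The disjunction spares the users a case distinction on the order of a and b. *)
Lemma mvt_near_slope (g dg : R -> R) (a b c e : R) :
  (forall t, (a <= t <= b) || (b <= t <= a) -> is_derive t 1 g (dg t) /\ `|dg t - c| <= e) ->
  `|g b - g a - c * (b - a)| <= e * `|b - a|.
Proof.
wlog: a b / a <= b => [hw h|ab h].
  have [ab|/ltW ba] := leP a b; first exact: hw.
  have -> : g b - g a - c * (b - a) = - (g a - g b - c * (a - b)) by ring.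
  by rewrite normrN [X in e * X]distrC; apply: hw => // t; rewrite orbC; exact: h.
have [||t] := @MVT_segment R g dg a b ab.
- move=> t; rewrite in_itv/= => /andP[/ltW h1 /ltW h2]; by have [|] := h t; rewrite ?h1 ?h2.
- apply: derivable_within_continuous => t; rewrite in_itv/= => /andP[h1 h2].
  by have [|[]] := h t; rewrite ?h1 ?h2.
rewrite in_itv/= => tab ->; have [|_ ht] := h t; first by rewrite tab.
by rewrite -mulrBl normrM ler_wpM2r.
Qed.

(** The linear map that sends the unit vectors of the plane to a and b. It serves as a candidate
    differential and, when a and b are the partial derivatives of a chart, as a parametrization of
    the tangent plane. *)
Definition lin2 (W : normedModType R) (a b : W) (v : R2 R) : W := v.1 *: a + v.2 *: b.

Lemma lin2_linear (W : normedModType R) (a b : W) : linear (lin2 a b).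
Proof. by move=> k u v; rewrite /lin2/= !scalerDl !scalerDr !scalerA addrACA. Qed.

HB.instance Definition _ (W : normedModType R) (a b : W) :=
  GRing.isLinear.Build _ _ _ _ (lin2 a b) (@lin2_linear W a b).

Lemma lin2_continuous (W : normedModType R) (a b : W) : continuous (lin2 a b).
Proof.
move=> v; apply: cvgD; apply: cvgZr_tmp; [exact: cvg_fst|exact: cvg_snd].
Qed.

Lemma is_derive_slice1 (f : R2 R -> R) (t s : R) :
  derivable f (t, s) (1, 0) -> is_derive t 1 (fun t => f (t, s)) ('D_(1, 0) f (t, s)).
Proof.
have E : (fun h : R => h^-1 *: (((fun t => f (t, s)) \o shift t) (h *: 1) - f (t, s))) =
   (fun h : R => h^-1 *: ((f \o shift (t, s)) (h *: (1, 0)) - f (t, s))).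
  apply: funext => h /=; congr (_ *: (f _ - _)).
  by rewrite [RHS]surjective_pairing /= scaler0 add0r.
by move=> df; split; rewrite /derivable/derive E.
Qed.

Lemma is_derive_slice2 (f : R2 R -> R) (t s : R) :
  derivable f (t, s) (0, 1) -> is_derive s 1 (fun s => f (t, s)) ('D_(0, 1) f (t, s)).
Proof.
have E : (fun h : R => h^-1 *: (((fun s => f (t, s)) \o shift s) (h *: 1) - f (t, s))) =
   (fun h : R => h^-1 *: ((f \o shift (t, s)) (h *: (0, 1)) - f (t, s))).
  apply: funext => h /=; congr (_ *: (f _ - _)).
  by rewrite [RHS]surjective_pairing /= scaler0 add0r.
by move=> df; split; rewrite /derivable/derive E.
Qed.

(** The increment is split along a horizontal and a vertical segment, and the mean value theorem is
    applied to each. Balls of the max norm are squares, so both segments stay in the ball, and each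
    coordinate difference is at most the norm, so that e / 2 per segment suffices. *)
Lemma partials_differentiable (U : set (R2 R)) (f : R2 R -> R) q :
  open U -> U q ->
  (forall x, U x -> derivable f x (1, 0) /\ derivable f x (0, 1)) ->
  {for q, continuous ('D_(1, 0) f)} -> {for q, continuous ('D_(0, 1) f)} ->
  differentiable f q.
Proof.
move=> oU Uq df c1 c2.
have [] // := @le_differentiable _ _ f q (lin2 ('D_(1, 0) f q) ('D_(0, 1) f q)).
  exact: lin2_continuous.
move=> e e0; have e20 : 0 < e / 2 by rewrite divr_gt0.
have nU : \forall y \near q, U y by exact: open_nbhs_nbhs.
move/cvgrPdist_le : c1 => /(_ _ e20) n1; move/cvgrPdist_le : c2 => /(_ _ e20) n2.
have nn : nbhs q (U `&` ([set y | `|'D_(1, 0) f q - 'D_(1, 0) f y| <= e / 2] `&`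
    [set y | `|'D_(0, 1) f q - 'D_(0, 1) f y| <= e / 2])).
  exact: (filterI nU (filterI n1 n2)).
have /nbhs_ballP[r /= r0 hr] := nn.
apply/nbhs_ballP; exists r => //= -[y1 y2] [/= b1 b2].
case: q Uq hr b1 b2 {n1 n2 nU nn} => q1 q2 Uq hr /= b1 b2.
have rr (t a b : R) : ball a r b -> (a <= t <= b) || (b <= t <= a) -> ball a r t.
  rewrite /ball/= !ltr_distl => /andP[x1 x2] /orP[]/andP[x3 x4]; apply/andP; lra.
have A1 := @mvt_near_slope (fun t => f (t, y2)) (fun t => 'D_(1, 0) f (t, y2)) q1 y1
  ('D_(1, 0) f (q1, q2)) (e / 2).
have A2 := @mvt_near_slope (fun t => f (q1, t)) (fun t => 'D_(0, 1) f (q1, t)) q2 y2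
  ('D_(0, 1) f (q1, q2)) (e / 2).
rewrite /lin2/= -[y1 - _]/(y1 - q1) -[y2 - _]/(y2 - q2).
have -> : f (y1, y2) - f (q1, q2) -
   ((y1 - q1) *: 'D_(1, 0) f (q1, q2) + (y2 - q2) *: 'D_(0, 1) f (q1, q2)) =
   (f (y1, y2) - f (q1, y2) - 'D_(1, 0) f (q1, q2) * (y1 - q1)) +
   (f (q1, y2) - f (q1, q2) - 'D_(0, 1) f (q1, q2) * (y2 - q2)).
  by rewrite /GRing.scale/=; ring.
apply: (le_trans (ler_normD _ _)).
apply: (@le_trans _ _ (e / 2 * `|y1 - q1| + e / 2 * `|y2 - q2|)).
  apply: lerD.
    apply: A1 => t tt.
    have [Ut [D1 _]] := hr (t, y2) (conj (rr _ _ _ b1 tt) b2).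
    split; first by apply: is_derive_slice1; exact: (proj1 (df _ Ut)).
    by rewrite distrC; exact: D1.
  apply: A2 => t tt.
  have [Ut [_ D2]] := hr (q1, t) (conj (ballxx q1 r0) (rr _ _ _ b2 tt)).
  split; first by apply: is_derive_slice2; exact: (proj2 (df _ Ut)).
  by rewrite distrC; exact: D2.
rewrite -mulrDr -mulrA ler_pM2l// prod_normE/=.
have := le_max `|y1 - q1| `|y1 - q1| `|y2 - q2|; rewrite lexx/= => m1.
have := le_max `|y2 - q2| `|y1 - q1| `|y2 - q2|; rewrite lexx orbT/= => m2.
lra.
Qed.

End differentiability.

(** * Continuously differentiable maps *)

Section smoothness.
Context {R : realType}.


Lemma dotE (x y : R3 R) : dot x y = x.1.1 * y.1.1 + x.1.2 * y.1.2 + x.2 * y.2.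
Proof. by rewrite /dot !big_ord_recr big_ord0/= add0r. Qed.

Lemma dotC (x y : R3 R) : dot x y = dot y x.
Proof. by rewrite !dotE; ring. Qed.

Lemma dotDl (x y z : R3 R) : dot (x + y) z = dot x z + dot y z.
Proof. by rewrite !dotE/=; ring. Qed.

Lemma dotZl k (x y : R3 R) : dot (k *: x) y = k * dot x y.
Proof. by rewrite !dotE/= /GRing.scale/=; ring. Qed.

Lemma dotBl (x y z : R3 R) : dot (x - y) z = dot x z - dot y z.
Proof. by rewrite !dotE/=; ring. Qed.

Lemma dotBr (x y z : R3 R) : dot z (x - y) = dot z x - dot z y.
Proof. by rewrite !dotE/=; ring. Qed.

Lemma dot0l (x : R3 R) : dot 0 x = 0.
Proof. by rewrite !dotE/=; ring. Qed.

Lemma dot_ge0 (x : R3 R) : 0 <= dot x x.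
Proof. by rewrite dotE -!expr2 !addr_ge0 ?sqr_ge0. Qed.

Lemma dot_eq0 (x : R3 R) : dot x x = 0 -> x = 0.
Proof.
move=> /eqP; rewrite dotE -!expr2 paddr_eq0 ?addr_ge0 ?sqr_ge0//.
rewrite paddr_eq0 ?sqr_ge0// !sqrf_eq0 => /andP[/andP[/eqP h1 /eqP h2] /eqP h3].
by case: x h1 h2 h3 => -[a b] c /= -> -> ->.
Qed.

Lemma norm3_le (x : R3 R) (M : R) :
  (`|x| <= M) = [&& `|x.1.1| <= M, `|x.1.2| <= M & `|x.2| <= M].
Proof. by rewrite prod_normE/= ge_max prod_normE/= ge_max andbA. Qed.

Lemma dot_le (x y : R3 R) : `|dot x y| <= 3 * (`|x| * `|y|).
Proof.
have := norm3_le x `|x|; rewrite lexx => /esym/and3P[x1 x2 x3].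
have := norm3_le y `|y|; rewrite lexx => /esym/and3P[y1 y2 y3].
rewrite dotE; apply: (le_trans (ler_normD _ _)).
apply: (le_trans (lerD (ler_normD _ _) (lexx _))).
rewrite !normrM; have -> : 3 * (`|x| * `|y|) = `|x| * `|y| + `|x| * `|y| + `|x| * `|y| by ring.
by rewrite !lerD// ler_pM.
Qed.

Lemma fst_continuous (V W : normedModType R) : continuous (fst : V * W -> V).
Proof. by move=> z; exact: cvg_fst. Qed.

Lemma snd_continuous (V W : normedModType R) : continuous (snd : V * W -> W).
Proof. by move=> z; exact: cvg_snd. Qed.

Lemma cvg_dot (T : topologicalType) (F : set_system T) (FF : Filter F) (f g : T -> R3 R) (a b : R3 R) :
  f @ F --> a -> g @ F --> b -> dot (f x) (g x) @[x --> F] --> dot a b.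
Proof.
move=> fa gb; rewrite dotE; under eq_fun do rewrite dotE.
have c1 (h : T -> R3 R) (c : R3 R) : h @ F --> c -> [/\ (h x).1.1 @[x --> F] --> c.1.1,
   (h x).1.2 @[x --> F] --> c.1.2 & (h x).2 @[x --> F] --> c.2].
  move=> hc; have h1 := cvg_comp _ _ hc (@fst_continuous _ _ c).
  split; [exact: (cvg_comp _ _ h1 (@fst_continuous _ _ _))| |].
    exact: (cvg_comp _ _ h1 (@snd_continuous _ _ _)).
  exact: (cvg_comp _ _ hc (@snd_continuous _ _ _)).
have [f1 f2 f3] := c1 _ _ fa; have [g1 g2 g3] := c1 _ _ gb.
by apply: cvgD; [apply: cvgD|]; apply: cvgM.
Qed.

Lemma is_derive_fst (V W W' : normedModType R) (f : V -> W * W') x v :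
  derivable f x v -> is_derive x v (fst \o f) ('D_v f x).1.
Proof. by apply: is_derive_lin => z; exact: cvg_fst. Qed.

Lemma is_derive_snd (V W W' : normedModType R) (f : V -> W * W') x v :
  derivable f x v -> is_derive x v (snd \o f) ('D_v f x).2.
Proof. by apply: is_derive_lin => z; exact: cvg_snd. Qed.

(** [smooth_on] speaks of directional derivatives only; total differentiability, on which the chain
    rule rests, is therefore recorded as well. *)
Definition C1 (V W : normedModType R) (U : set V) (f : V -> W) :=
  forall x, U x -> differentiable f x /\ forall v, {for x, continuous ('D_v f)}.

Lemma C1_pair (V W W' : normedModType R) U (f : V -> W) (g : V -> W') :
  open U -> C1 U f -> C1 U g -> C1 U (fun x => (f x, g x)).
Proof.
move=> oU hf hg x Ux; have [df cf] := hf _ Ux; have [dg cg] := hg _ Ux.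
split=> [|v]; first exact: differentiable_pair.
have E : {near x, 'D_v (fun x => (f x, g x)) =1 fun y => ('D_v f y, 'D_v g y)}.
  have : \forall y \near x, U y by exact: open_nbhs_nbhs.
  apply: filterS => y Uy.
  have [{}df _] := hf _ Uy; have [{}dg _] := hg _ Uy.
  by rewrite !deriveE ?diff_pair//; exact: differentiable_pair.
apply: (cvg_trans (near_eq_cvg _) _); last first.
  rewrite (nbhs_singleton E); apply: cvg_pair; [exact: cf|exact: cg].
by apply: filterS E => y ->.
Qed.


Lemma smooth_derive (V W : normedModType R) (U : set V) (f : V -> W) :
  smooth_on U f -> forall x, U x -> forall v, derivable f x v /\ {for x, continuous ('D_v f)}.
Proof.
by move=> sf x Ux v; have [_ h] := sf [::] x Ux; have [c _] := sf [:: v] x Ux.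
Qed.

Lemma partials_C1 (U : set (R2 R)) (f : R2 R -> R) : open U ->
  (forall x, U x -> forall v, derivable f x v /\ {for x, continuous ('D_v f)}) -> C1 U f.
Proof.
move=> oU h x Ux; split=> [|v]; last by have [] := h _ Ux v.
apply: (partials_differentiable oU Ux); last 2 first.
- by have [] := h _ Ux (1, 0).
- by have [] := h _ Ux (0, 1).
by move=> y Uy; split; [have [] := h _ Uy (1, 0)|have [] := h _ Uy (0, 1)].
Qed.

(** The criterion by partial derivatives concerns real functions, so the map is taken apart into its
    three coordinates and reassembled. *)
Lemma smooth_C1 (U : set (R2 R)) (psi : R2 R -> R3 R) : open U -> smooth_on U psi -> C1 U psi.
Proof.
move=> oU /smooth_derive h.
have hfst (W W' : normedModType R) (f : R2 R -> W * W') :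
    (forall x, U x -> forall v, derivable f x v /\ {for x, continuous ('D_v f)}) ->
    (forall x, U x -> forall v, derivable (fst \o f) x v /\ {for x, continuous ('D_v (fst \o f))}).
  move=> {}h x Ux v; have [d c] := h _ Ux v; have [d' e'] := is_derive_fst d.
  split=> //; have E : {near x, fst \o 'D_v f =1 'D_v (fst \o f)}.
    have : \forall y \near x, U y by exact: open_nbhs_nbhs.
    by apply: filterS => y Uy; have [dy _] := h _ Uy v; have [_ ->] := is_derive_fst dy.
  apply: (cvg_trans (near_eq_cvg E)); rewrite e'.
  by apply: (cvg_comp _ _ c); exact: fst_continuous.
have hsnd (W W' : normedModType R) (f : R2 R -> W * W') :
    (forall x, U x -> forall v, derivable f x v /\ {for x, continuous ('D_v f)}) ->
    (forall x, U x -> forall v, derivable (snd \o f) x v /\ {for x, continuous ('D_v (snd \o f))}).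
  move=> {}h x Ux v; have [d c] := h _ Ux v; have [d' e'] := is_derive_snd d.
  split=> //; have E : {near x, snd \o 'D_v f =1 'D_v (snd \o f)}.
    have : \forall y \near x, U y by exact: open_nbhs_nbhs.
    by apply: filterS => y Uy; have [dy _] := h _ Uy v; have [_ ->] := is_derive_snd dy.
  apply: (cvg_trans (near_eq_cvg E)); rewrite e'.
  by apply: (cvg_comp _ _ c); exact: snd_continuous.
have -> : psi = fun y => (((fst \o (fst \o psi)) y, (snd \o (fst \o psi)) y), (snd \o psi) y).
  by apply: funext => y /=; case: (psi y) => -[].
apply: C1_pair => //; last by apply: partials_C1 => //; exact: hsnd.
by apply: C1_pair => //; apply: partials_C1 => //; [exact: hfst (hfst _ _ _ h)|exact: hsnd (hfst _ _ _ h)].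
Qed.

Lemma C1_cst (V W : normedModType R) (U : set V) (c : W) : C1 U (cst c).
Proof.
move=> x Ux; split; first exact: differentiable_cst.
by move=> v; rewrite (_ : 'D_v _ = cst 0) ?funeqE//; [exact: cvg_cst|move=> y; exact: derive_cst].
Qed.

Lemma C1_ext (V W : normedModType R) (U : set V) (f : V -> W) (df : V -> V -> W) : open U ->
  (forall x, U x -> differentiable f x) ->
  (forall x v, U x -> 'D_v f x = df v x) ->
  (forall x v, U x -> {for x, continuous (df v)}) -> C1 U f.
Proof.
move=> oU h dE dc x Ux; split=> [|v]; first exact: h.
have E : {near x, df v =1 'D_v f}.
  have : \forall y \near x, U y by exact: open_nbhs_nbhs.
  by apply: filterS => y Uy; rewrite dE.
apply: (cvg_trans (near_eq_cvg E)); rewrite (dE _ _ Ux); exact: dc.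
Qed.

Lemma C1D (V : normedModType R) (U : set V) (f g : V -> R) : open U -> C1 U f -> C1 U g ->
  C1 U (fun x => f x + g x).
Proof.
move=> oU hf hg; apply: (C1_ext (df := fun v x => 'D_v f x + 'D_v g x)) => // x.
- by move=> /[dup]/hf[df _] /hg[dg _]; exact: differentiableD.
- move=> v /[dup]/hf[df _] /hg[dg _]; rewrite -[RHS]deriveD//; exact: diff_derivable.
- by move=> v /[dup]/hf[_ cf] /hg[_ cg]; apply: cvgD; [exact: cf|exact: cg].
Qed.

Lemma C1M (V : normedModType R) (U : set V) (f g : V -> R) : open U -> C1 U f -> C1 U g ->
  C1 U (fun x => f x * g x).
Proof.
move=> oU hf hg.
apply: (C1_ext (df := fun v x => f x *: 'D_v g x + g x *: 'D_v f x)) => // x.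
- by move=> /[dup]/hf[df _] /hg[dg _]; exact: differentiableM.
- move=> v /[dup]/hf[df _] /hg[dg _]; rewrite -[RHS]deriveM//; exact: diff_derivable.
- move=> v /[dup]/hf[df cf] /hg[dg cg].
  have := differentiable_continuous df; have := differentiable_continuous dg.
  by move=> cg0 cf0; apply: cvgD; apply: cvgZ => //; [exact: cg|exact: cf].
Qed.

Lemma C1_lin (V W : normedModType R) (L : {linear V -> W}) : continuous L -> C1 setT L.
Proof.
move=> cL x _.
have dL y : differentiable L y /\ 'd L y = L :> (V -> W).
  apply: le_differentiable => // e e0; near=> z.
  by rewrite linearB subrr normr0 mulr_ge0// ltW.
split; first by have [] := dL x.
move=> v; rewrite (_ : 'D_v _ = cst (L v)); first exact: cvg_cst.
by apply: funext => y; have [dy dE] := dL y; rewrite deriveE// dE.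
Unshelve. all: by end_near. Qed.

(** [coord] with the index first, so that it can carry a linear structure. *)
Definition coordL (i : 'I_3) (x : R3 R) : R := Defs.coord x i.

Lemma coord_linear i : linear (coordL i).
Proof. by case: i => [[|[|[|//]]]] ? k u v. Qed.

HB.instance Definition _ i := GRing.isLinear.Build _ _ _ _ (coordL i) (@coord_linear i).

Lemma coord_continuous (i : 'I_3) : continuous (coordL i).
Proof.
have f1 z := cvg_comp _ _ (@fst_continuous (R * R)%type R z) (@fst_continuous R R z.1).
have f2 z := cvg_comp _ _ (@fst_continuous (R * R)%type R z) (@snd_continuous R R z.1).
by case: i => [[|[|[|//]]]] ? z; [exact: f1|exact: f2|exact: snd_continuous].
Qed.

Lemma C1_coord i : C1 setT (coordL i).
Proof. by apply: (@C1_lin _ _ (coordL i)); exact: coord_continuous. Qed.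

Lemma C1_sum (V : normedModType R) (U : set V) I (r : seq I) (F : I -> V -> R) : open U ->
  (forall i, C1 U (F i)) -> C1 U (fun x => \sum_(i <- r) F i x).
Proof.
move=> oU h; elim: r => [|i r IH].
  by under eq_fun do rewrite big_nil; exact: C1_cst.
rewrite (_ : (fun x => _) = (fun x => F i x + \sum_(j <- r) F j x)).
  exact: (C1D oU (h i) IH).
by apply: funext => x; rewrite big_cons.
Qed.

Lemma C1_prod (V : normedModType R) (U : set V) I (r : seq I) (F : I -> V -> R) : open U ->
  (forall i, C1 U (F i)) -> C1 U (fun x => \prod_(i <- r) F i x).
Proof.
move=> oU h; elim: r => [|i r IH].
  by under eq_fun do rewrite big_nil; exact: C1_cst.
rewrite (_ : (fun x => _) = (fun x => F i x * \prod_(j <- r) F j x)).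
  exact: (C1M oU (h i) IH).
by apply: funext => x; rewrite big_cons.
Qed.

Lemma C1X (V : normedModType R) (U : set V) (f : V -> R) n : open U ->
  C1 U f -> C1 U (fun x => f x ^+ n).
Proof.
move=> oU h; elim: n => [|n IH].
  by under eq_fun do rewrite expr0; exact: C1_cst.
rewrite (_ : (fun x => _) = (fun x => f x * f x ^+ n)); first exact: (C1M oU h IH).
by apply: funext => x; rewrite exprS.
Qed.

Lemma C1_meval (p : mpoly.mpoly 3 R) : C1 setT (fun x : R3 R => mpoly.meval (Defs.coord x) p).
Proof.
have oT : open (setT : set (R3 R)) := openT.
under eq_fun do rewrite mpoly.mevalE.
apply: C1_sum => // m; apply: C1M => //; first exact: C1_cst.
apply: C1_prod => // i; apply: C1X => //; exact: (C1_coord i).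
Qed.

Definition grad3 (p : R3 R -> R) (y : R3 R) : R3 R :=
  ('D_((1, 0), 0) p y, 'D_((0, 1), 0) p y, 'D_((0, 0), 1) p y).

Lemma grad3E (p : R3 R -> R) (y w : R3 R) : differentiable p y -> 'D_w p y = dot (grad3 p y) w.
Proof.
move=> dp; rewrite dotE /grad3/= !deriveE//.
have {1}-> : w = w.1.1 *: ((1, 0), 0) + w.1.2 *: ((0, 1), 0) + w.2 *: ((0, 0), 1).
  case: w => -[a b] c; congr (_, _, _); rewrite /= /GRing.scale/=; ring.
by rewrite !linearD !linearZ /= /GRing.scale/=; ring.
Qed.

Lemma grad3_continuous (p : R3 R -> R) : C1 setT p -> continuous (grad3 p).
Proof. by move=> hp y; have [_ c] := hp y I; exact: (cvg_pair (cvg_pair (c _) (c _)) (c _)). Qed.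

Lemma C1_comp (U : set (R2 R)) (psi : R2 R -> R3 R) (p : R3 R -> R) :
  open U -> C1 U psi -> C1 setT p ->
  C1 U (p \o psi) /\ forall q v, U q -> 'D_v (p \o psi) q = dot (grad3 p (psi q)) ('D_v psi q).
Proof.
move=> oU hpsi hp.
have dE q v : U q -> 'D_v (p \o psi) q = dot (grad3 p (psi q)) ('D_v psi q).
  move=> /hpsi[dpsi _]; have [dp _] := hp (psi q) I.
  have dc : differentiable (p \o psi) q by exact: differentiable_comp.
  by rewrite -(grad3E _ dp) (deriveE _ dc) (deriveE _ dp) (deriveE _ dpsi) (diff_comp dpsi dp).
split; last by move=> q v; exact: dE.
apply: (@C1_ext _ _ U _ (fun v q => dot (grad3 p (psi q)) ('D_v psi q)) oU).
- move=> q /hpsi[dpsi _]; have [dp _] := hp (psi q) I; exact: differentiable_comp.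
- by move=> q v Uq; exact: dE.
move=> q v /hpsi[dpsi cpsi]; apply: cvg_dot; last exact: cpsi.
have c1 : psi @ q --> psi q := differentiable_continuous dpsi.
exact: (cvg_comp psi (grad3 p) c1 (@grad3_continuous _ hp (psi q))).
Qed.
End smoothness.

(** * Zero sets of functions with nonzero slope *)

Section null_sets.
Context {R : realType}.

(** Each point of S is labelled by a rational interval that meets S in this point only; the label
    determines the point. *)
Lemma isolated_countable (S : set R) :
  (forall x, S x -> \forall y \near x, S y -> y = x) -> countable S.
Proof.
move=> hS.
have /choice[f hf] : forall x, exists i, S x -> rat_itv i x /\ (forall y, rat_itv i y -> S y -> y = x).
  move=> x; have [Sx|nSx] := pselect (S x); last by exists (0, 0).
  by have [i ix iS] := rat_itv_base (hS _ Sx); exists i.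
apply/countable_injP; exists (pickle \o f) => x y /set_mem Sx /set_mem Sy /= /(pcan_inj pickleK) E.
have [fx hx] := hf _ Sx; have [fy hy] := hf _ Sy.
by apply: hy => //; rewrite -E.
Qed.

Lemma zero_slope_neq0 (g : R2 R -> R) (q v : R2 R) : differentiable g q ->
  g q = 0 -> 'D_v g q != 0 -> \forall t \near (0 : R), g (q + t *: v) = 0 -> t = 0.
Proof.
move=> dg g0; set c := 'D_v g q => c0.
(* With this e the error term is at most e * |t| * |v| < |c| * |t|, so it cannot cancel the linear
   term t * c. The added 1 keeps the denominator positive without a case on v. *)
pose e := `|c| / (2 * (`|v| + 1)).
have v1 : 0 < `|v| + 1 by rewrite ltr_wpDl.
have e0 : 0 < e by rewrite divr_gt0 ?mulr_gt0 ?normr_gt0.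
have cv : q + t *: v @[t --> (0 : R)] --> q.
  rewrite -[X in _ --> X]addr0 -(scale0r v).
  by apply: cvgD; [exact: cvg_cst|apply: cvgZr_tmp; exact: cvg_id].
have : \forall t \near (0 : R), `|g (q + t *: v) - g q - 'd g q (q + t *: v - q)| <= e * `|q + t *: v - q|.
  exact: (cv _ (differentiable_le dg e0)).
apply: filterS => t /= + gt0.
rewrite gt0 g0 subr0 sub0r normrN addrC addKr linearZ normrZ normrZ -deriveE// -/c => h.
apply/eqP/negPn/negP => t0; move: h; apply/negP; rewrite -ltNge mulrCA ltr_pM2l ?normr_gt0//.
rewrite /e mulrAC ltr_pdivrMr ?mulr_gt0// -subr_gt0.
have -> : `|c| * (2 * (`|v| + 1)) - `|c| * `|v| = `|c| * (`|v| + 2) by ring.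
by rewrite mulr_gt0 ?normr_gt0// ltr_wpDl.
Qed.

Lemma zero_slope_measurable (U : set (R2 R)) (g : R2 R -> R) v : open U -> C1 U g ->
  measurable [set q | [/\ U q, g q = 0 & 'D_v g q != 0]].
Proof.
move=> oU hg; have mU : measurable U by exact: open_measurable2.
have cU (h : R2 R -> R) : (forall q, U q -> {for q, continuous h}) -> measurable_fun U h.
  move=> ch; apply: within_measurable2 => //.
  by apply: continuous_in_subspaceT => q /set_mem; exact: ch.
have m1 : measurable_fun U g.
  by apply: cU => q /hg[dg _]; exact: differentiable_continuous.
have m2 : measurable_fun U ('D_v g) by apply: cU => q /hg[_].
have -> : [set q | [/\ U q, g q = 0 & 'D_v g q != 0]] =
   (U `&` g @^-1` [set 0]) `&` (U `&` 'D_v g @^-1` (~` [set 0])).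
  by apply/seteqP; split=> q /=; [move=> [? ? /eqP]|move=> [[? ?] [_ /eqP]]].
by apply: measurableI; [apply: m1|apply: m2] => //; apply: measurableC.
Qed.

(* The slices by the lines on which the first coordinate is constant consist of
   isolated points, hence are countable. *)
Lemma zero_slope_null2 (U : set (R2 R)) (g : R2 R -> R) : open U -> C1 U g ->
  lebesgue2 [set q | [/\ U q, g q = 0 & 'D_(0, 1) g q != 0]] = 0%E.
Proof.
move=> oU hg; set A := [set _ | _].
rewrite /lebesgue2 /= /product_measure1; apply: integral0_eq => x _ /=.
apply: countable_lebesgue_measure0; apply: isolated_countable => s.
rewrite /xsection/= inE => -[Us g0 D0]; have [dg _] := hg _ Us.
have := zero_slope_neq0 dg g0 D0.
rewrite (near_shift s 0) sub0r; apply: filterS => t /= h; rewrite inE => -[_ gt _].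
apply/eqP; rewrite -subr_eq0; apply/eqP/h; rewrite -{}[RHS]gt; congr g.
by rewrite [LHS]surjective_pairing/= scaler0 addr0 /GRing.scale/= mulr1 addrC subrK.
Qed.

(** The product measure integrates the slices with constant first coordinate, whereas here those
    with constant second coordinate are countable; Tonelli's theorem exchanges them, which is where
    measurability of the set enters. *)
Lemma zero_slope_null1 (U : set (R2 R)) (g : R2 R -> R) : open U -> C1 U g ->
  lebesgue2 [set q | [/\ U q, g q = 0 & 'D_(1, 0) g q != 0]] = 0%E.
Proof.
move=> oU hg; set A := [set _ | _].
have mA : measurable A by exact: zero_slope_measurable.
pose m := @lebesgue_measure R.
have E : (\int[m]_x (m \o xsection A) x = \int[m]_y (m \o ysection A) y)%E.
  rewrite -(indic_fubini_tonelli_FE m mA) -(indic_fubini_tonelli_GE m mA).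
  exact: indic_fubini_tonelli.
transitivity (\int[m]_y (m \o ysection A) y)%E; first exact: E.
apply: integral0_eq => s _ /=.
apply: countable_lebesgue_measure0; apply: isolated_countable => x.
rewrite /ysection/= inE => -[Us g0 D0]; have [dg _] := hg _ Us.
have := zero_slope_neq0 dg g0 D0.
rewrite (near_shift x 0) sub0r; apply: filterS => t /= h; rewrite inE => -[_ gt _].
apply/eqP; rewrite -subr_eq0; apply/eqP/h; rewrite -{}[RHS]gt; congr g.
by rewrite [LHS]surjective_pairing/= scaler0 addr0 /GRing.scale/= mulr1 addrC subrK.
Qed.

End null_sets.

(** * Charts and surface gradients *)

Section charts.
Context {R : realType}.
Variable Gamma : set (R3 R).
Implicit Types (psi : R2 R -> R3 R).

(** The quantity under the root in [area_density]; it is positive exactly when the two partial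
    derivatives are linearly independent. *)
Definition gram psi q : R :=
  let a := 'D_(1, 0) psi q in let b := 'D_(0, 1) psi q in
  dot a a * dot b b - dot a b ^+ 2.

Lemma dot_lin2r (w a b : R3 R) v : dot w (lin2 a b v) = v.1 * dot w a + v.2 * dot w b.
Proof. by rewrite !dotE /lin2 /= /GRing.scale/=; ring. Qed.

Lemma dot_lin2l (w a b : R3 R) v : dot (lin2 a b v) w = v.1 * dot a w + v.2 * dot b w.
Proof. by rewrite !dotE /lin2 /= /GRing.scale/=; ring. Qed.

Lemma derive_lin2 psi (q v : R2 R) : differentiable psi q ->
  'D_v psi q = lin2 ('D_(1, 0) psi q) ('D_(0, 1) psi q) v.
Proof.
move=> dp; rewrite !deriveE// /lin2 -!linearZ -linearD; congr ('d psi q _).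
by rewrite [RHS]surjective_pairing/= !scaler0 addr0 add0r /GRing.scale/= !mulr1; case: v.
Qed.

Lemma chart_gram_gt0 U psi q : local_param Gamma U psi -> U q -> 0 < gram psi q.
Proof. by case=> _ _ _ h _ /h; rewrite /area_density sqrtr_gt0. Qed.

Lemma chart_C1 U psi : local_param Gamma U psi -> C1 U psi.
Proof. by case=> oU sp _ _ _; exact: smooth_C1. Qed.

Lemma chart_differentiable U psi q : local_param Gamma U psi -> U q -> differentiable psi q.
Proof. by move=> h Uq; have [] := chart_C1 h Uq. Qed.

(** Cramer's rule for the normal equations: the coefficients of the combination of a and b whose
    inner products with a and b are c1 and c2. For c1 = [dot w a] and c2 = [dot w b] this
    combination is the orthogonal projection of w onto the plane of a and b. *)
Definition gram_sol (a b : R3 R) (c1 c2 : R) : R2 R :=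
  ((dot b b * c1 - dot a b * c2) / (dot a a * dot b b - dot a b ^+ 2),
   (dot a a * c2 - dot a b * c1) / (dot a a * dot b b - dot a b ^+ 2)).

Lemma gram_solP (a b w : R3 R) v : 0 < dot a a * dot b b - dot a b ^+ 2 ->
  dot (lin2 a b (gram_sol a b (dot w a) (dot w b))) (lin2 a b v) = dot w (lin2 a b v).
Proof.
rewrite !dot_lin2r !dot_lin2l /gram_sol (dotC b a) /=.
move: (dot a a) (dot b b) (dot a b) (dot w a) (dot w b) v.1 v.2 => aa bb ab c1 c2 v1 v2 g0.
by field; rewrite gt_eqF.
Qed.

Lemma gram_sol_unique (a b : R3 R) v : 0 < dot a a * dot b b - dot a b ^+ 2 ->
  v = gram_sol a b (dot (lin2 a b v) a) (dot (lin2 a b v) b).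
Proof.
rewrite !dot_lin2l /gram_sol (dotC b a) /=.
move: (dot a a) (dot b b) (dot a b) => aa bb ab g0.
by case: v => v1 v2 /=; congr (_, _); field; rewrite gt_eqF.
Qed.

Definition tangent_sol psi q (c1 c2 : R) : R2 R :=
  gram_sol ('D_(1, 0) psi q) ('D_(0, 1) psi q) c1 c2.

Lemma tangent_solP psi q (w : R3 R) : differentiable psi q -> 0 < gram psi q ->
  forall v, dot ('D_(tangent_sol psi q (dot w ('D_(1, 0) psi q)) (dot w ('D_(0, 1) psi q))) psi q)
   ('D_v psi q) = dot w ('D_v psi q).
Proof.
move=> dp g0 v; have E u := derive_lin2 u dp.
have g1 := gram_solP w v g0.
exact: (etrans (congr2 dot (E _) (E v)) (etrans g1 (congr1 (dot w) (esym (E v))))).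
Qed.

(** Cramer's rule recovers v from the inner products of [lin2 a b v] with a and b, and these are
    bounded by its norm. The factor 3 in [L] comes from [dot_le], which compares the Euclidean
    product with the max norm. *)
Lemma lin2_lower_bound (a b : R3 R) : 0 < dot a a * dot b b - dot a b ^+ 2 ->
  exists2 C : R, 0 < C & forall v, `|v| <= C * `|lin2 a b v|.
Proof.
move=> g0; pose M := `|dot b b| + `|dot a b| + `|dot a a|.
pose D := dot a a * dot b b - dot a b ^+ 2.
pose L := 3 * (`|a| + `|b|).
have L0 : 0 <= L by rewrite mulr_ge0// addr_ge0.
pose C := M * L / D.
have M0 : 0 <= M by rewrite !addr_ge0.
have C0 : 0 <= C by apply: divr_ge0; [rewrite mulr_ge0|exact: ltW].
(* [C] itself is only known to be nonnegative. *)
exists (C + 1) => [|v]; first by rewrite ltr_wpDl.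
have E := gram_sol_unique v g0; set w := lin2 a b v in E *.
apply: (@le_trans _ _ (C * `|w|)); last by rewrite ler_wpM2r// lerDl.
have wa : `|dot w a| <= L * `|w|.
  apply: (le_trans (dot_le _ _)); rewrite /L -mulrA ler_pM2l// mulrC ler_wpM2r// lerDl.
  exact: normr_ge0.
have wb : `|dot w b| <= L * `|w|.
  apply: (le_trans (dot_le _ _)); rewrite /L -mulrA ler_pM2l// mulrC ler_wpM2r// lerDr.
  exact: normr_ge0.
have key (c1 c2 d1 d2 : R) : `|c1| + `|c2| <= M -> `|d1| <= L * `|w| -> `|d2| <= L * `|w| ->
    `|(c1 * d1 - c2 * d2) / D| <= C * `|w|.
  move=> h h1 h2; rewrite normrM normfV (gtr0_norm g0) /C mulrAC ler_pM2r ?invr_gt0//.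
  apply: (le_trans (ler_normB _ _)); rewrite !normrM -mulrA.
  apply: (@le_trans _ _ ((`|c1| + `|c2|) * (L * `|w|))).
    by rewrite mulrDl lerD// ler_wpM2l.
  by rewrite ler_wpM2r// mulr_ge0.
rewrite E /gram_sol prod_normE/= ge_max.
apply/andP; split; apply: key => //; rewrite /M; first by rewrite lerDl normr_ge0.
by rewrite -addrA (addrC `|dot a b|) lerDr normr_ge0.
Qed.

Lemma immersion_lower_bound psi q : differentiable psi q -> 0 < gram psi q ->
  exists2 C : R, 0 < C & forall v, `|v| <= C * `|'D_v psi q|.
Proof.
move=> dp /lin2_lower_bound[C C0 h]; exists C => // v.
by rewrite (derive_lin2 v dp).
Qed.

Lemma chart_image U psi q : local_param Gamma U psi -> U q ->
  \forall x \near psi q, Gamma x -> exists2 y, U y & psi y = x.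
Proof.
move=> [oU _ _ _ hO] Uq; have [V oV E] := hO setT openT.
have Vq : V (psi q).
  suff : (Gamma `&` V) (psi q) by case.
  by rewrite -E; exists q.
have : \forall x \near psi q, V x by exact: open_nbhs_nbhs.
apply: filterS => x Vx Gx.
have : (Gamma `&` V) x by [].
by rewrite -E => -[y [Uy _] <-]; exists y.
Qed.

Lemma chart_in U psi q : local_param Gamma U psi -> U q -> Gamma (psi q).
Proof.
move=> [oU _ _ _ hO] Uq; have [V oV E] := hO setT openT.
suff : (Gamma `&` V) (psi q) by case.
by rewrite -E; exists q.
Qed.

(** Continuity of the inverse of the chart, stated without naming the inverse: the image of a
    neighbourhood of q is relatively open, and injectivity identifies every preimage of x with the
    one taken in that neighbourhood. *)
Lemma chart_inv_continuous U psi q (A : set (R2 R)) : local_param Gamma U psi -> U q ->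
  nbhs q A -> \forall x \near psi q, forall y, U y -> psi y = x -> A y.
Proof.
move=> [oU _ inj _ hO] Uq; rewrite nbhsE => -[Q [oQ Qq] QA].
have [V oV E] := hO Q oQ.
have Vq : V (psi q).
  suff : (Gamma `&` V) (psi q) by case.
  by rewrite -E; exists q.
have : \forall x \near psi q, V x by exact: open_nbhs_nbhs.
apply: filterS => x Vx y Uy yx; apply: QA.
have : (Gamma `&` V) x.
  split=> //; have [V' oV' E'] := hO setT openT.
  suff : (Gamma `&` V') x by case.
  by rewrite -E' -yx; exists y.
rewrite -E => -[y' [Uy' Qy'] y'x].
by rewrite (_ : y = y')//; apply: inj; rewrite ?inE// yx.
Qed.

(** The differential satisfies |v| <= C * |d psi v|. The linearization error, at most |y - q| / (2 *
    C), costs half of |y - q| after multiplication by C and is absorbed on the left, whence the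
    constant 2 * C. Continuity of the inverse brings y close enough to q for the linearization to
    apply. *)
Lemma chart_inv_lipschitz U psi q : local_param Gamma U psi -> U q ->
  exists2 K : R, 0 < K &
    \forall x \near psi q, forall y, U y -> psi y = x -> `|y - q| <= K * `|x - psi q|.
Proof.
move=> hp Uq; have dp := chart_differentiable hp Uq.
have [C C0 hC] := immersion_lower_bound dp (chart_gram_gt0 hp Uq).
have e0 : 0 < (2 * C)^-1 by rewrite invr_gt0 mulr_gt0.
exists (2 * C); first by rewrite mulr_gt0.
have := chart_inv_continuous hp Uq (differentiable_le dp e0).
apply: filterS => x h y Uy yx; have := h y Uy yx; rewrite {}yx -deriveE// => hy.
have h2 := hC (y - q).
have h3 : `|'D_(y - q) psi q| <= `|x - psi q| + (2 * C)^-1 * `|y - q|.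
  rewrite -lerBlDl; apply: le_trans hy.
  by rewrite [leRHS]distrC lerB_dist.
have := le_trans h2 (ler_wpM2l (ltW C0) h3).
rewrite mulrDr mulrA invfM mulrCA divff ?gt_eqF// mulr1 => h4.
have -> : 2 * C * `|x - psi q| = 2 * (C * `|x - psi q|) by rewrite mulrA.
lra.
Qed.

End charts.

(** * Surface gradients as expansions in the ambient space *)

Section gradients.
Context {R : realType}.
Variable Gamma : set (R3 R).

(* A chart-free version of [is_surface_grad], without tangency: the expansion of
   [u] at [x] along [Gamma]. *)
Definition first_order (u : R3 R -> R) (x g : R3 R) :=
  forall e : R, 0 < e ->
    \forall y \near x, Gamma y -> `|u y - u x - dot g (y - x)| <= e * `|y - x|.

Lemma chart_locally_lipschitz U psi q : local_param Gamma U psi -> U q ->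
  exists2 L : R, 0 < L & \forall y \near q, `|psi y - psi q| <= L * `|y - q|.
Proof.
move=> hp Uq; have dp := chart_differentiable hp Uq.
have /linear_lipschitz[k k0 hk] : continuous ('d psi q) := diff_continuous dp.
exists (1 + k); first by rewrite addr_gt0.
have := differentiable_le dp ltr01; apply: filterS => y h.
rewrite -(subrK ('d psi q (y - q)) (psi y - psi q)).
by apply: (le_trans (ler_normD _ _)); rewrite mulrDl lerD.
Qed.

(** The expansion in the parameter has linear term [dot g A] with A = d psi (y - q); replacing A by
    x - psi q costs the linearization error of psi. Both errors are small against |y - q|, and the
    Lipschitz bound for the inverse chart compares |y - q| with |x - psi q|. *)
Lemma chart_first_order U psi q (u : R3 R -> R) (g : R3 R) :
  local_param Gamma U psi -> U q -> differentiable (u \o psi) q ->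
  (forall v, 'D_v (u \o psi) q = dot g ('D_v psi q)) -> first_order u (psi q) g.
Proof.
move=> hp Uq du hD e e0; have dp := chart_differentiable hp Uq.
have [K K0 hK] := chart_inv_lipschitz hp Uq.
(* [e1] leaves half of e after multiplication by K; [e2] further compensates the factor 3 * |g| of
   [dot_le], with 1 added to avoid a zero denominator. *)
pose e1 := e / (2 * K); pose e2 := e1 / (3 * (`|g| + 1)).
have g1 : 0 < `|g| + 1 by rewrite ltr_wpDl.
have e10 : 0 < e1 by rewrite divr_gt0// mulr_gt0.
have e20 : 0 < e2 by rewrite divr_gt0// mulr_gt0.
have n1 := differentiable_le du e10; have n2 := differentiable_le dp e20.
have nn : \forall y \near q, `|(u \o psi) y - (u \o psi) q - 'd (u \o psi) q (y - q)| <= e1 * `|y - q| /\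
   `|psi y - psi q - 'd psi q (y - q)| <= e2 * `|y - q|.
  by near=> y; split; near: y.
have m1 := chart_inv_continuous hp Uq nn.
have m2 := chart_image hp Uq.
near=> x => Gx.
have [y Uy yx] : exists2 y, U y & psi y = x by move: Gx; near: x.
have yK : `|y - q| <= K * `|x - psi q|.
  by move: (y) Uy yx; near: x.
have [h1 h2] : `|(u \o psi) y - (u \o psi) q - 'd (u \o psi) q (y - q)| <= e1 * `|y - q| /\
   `|psi y - psi q - 'd psi q (y - q)| <= e2 * `|y - q|.
  by move: (y) Uy yx {yK}; near: x.
rewrite -deriveE// hD /= yx in h1; rewrite -deriveE// yx in h2.
set A := 'D_(y - q) psi q in h1 h2.
have -> : u x - u (psi q) - dot g (x - psi q) =
  (u x - u (psi q) - dot g A) - dot g (x - psi q - A).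
  by rewrite (dotBr _ A); ring.
apply: (le_trans (ler_normB _ _)).
have h3 := dot_le g (x - psi q - A).
have h4 : 3 * (`|g| * `|x - psi q - A|) <= e1 * `|y - q|.
  apply: (@le_trans _ _ (3 * ((`|g| + 1) * (e2 * `|y - q|)))).
    rewrite ler_pM2l//; apply: ler_pM => //; by rewrite lerDl.
  by rewrite /e2 le_eqVlt; apply/orP; left; apply/eqP; field; rewrite gt_eqF.
have h5 : e1 * `|y - q| <= e / 2 * `|x - psi q|.
  apply: (le_trans (ler_wpM2l (ltW e10) yK)); rewrite /e1 le_eqVlt; apply/orP; left.
  by apply/eqP; field; rewrite gt_eqF.
have -> : e * `|x - psi q| = e / 2 * `|x - psi q| + e / 2 * `|x - psi q| by field.
by apply: lerD; [exact: (le_trans h1 h5)|exact: (le_trans h3 (le_trans h4 h5))].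
Unshelve. all: by end_near. Qed.

(** The converse, in an arbitrary chart at the point: here the Lipschitz bound of psi itself
    compares the two distances. With [chart_first_order] it carries a derivative from one chart to
    another. *)
Lemma first_order_chart U psi q (u : R3 R -> R) (g : R3 R) :
  local_param Gamma U psi -> U q -> first_order u (psi q) g ->
  differentiable (u \o psi) q /\ forall v, 'D_v (u \o psi) q = dot g ('D_v psi q).
Proof.
move=> hp Uq fo; have dp := chart_differentiable hp Uq.
have oU : open U by case: hp.
have [L L0 hL] := chart_locally_lipschitz hp Uq.
have cp := differentiable_continuous dp.
pose df : {linear R2 R -> R} := lin2 (dot g ('D_(1, 0) psi q)) (dot g ('D_(0, 1) psi q)).
have dfE v : df v = dot g ('D_v psi q).
  by rewrite (derive_lin2 v dp) dot_lin2r.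
have [||du dE] := @le_differentiable _ _ _ (u \o psi) q df.
- exact: lin2_continuous.
- move=> e e0.
  pose e1 := e / (2 * L); pose e2 := e / (2 * (3 * (`|g| + 1))).
  have g1 : 0 < `|g| + 1 by rewrite ltr_wpDl.
  have e10 : 0 < e1 by rewrite divr_gt0// mulr_gt0.
  have e20 : 0 < e2 by rewrite divr_gt0// mulr_gt0// mulr_gt0.
  have n1 : \forall y \near q, Gamma (psi y) ->
     `|u (psi y) - u (psi q) - dot g (psi y - psi q)| <= e1 * `|psi y - psi q|.
    exact: (cp _ (fo e1 e10)).
  have n2 := differentiable_le dp e20.
  have nU : \forall y \near q, U y by exact: open_nbhs_nbhs.
  near=> y.
  have Uy : U y by near: y.
  have yL : `|psi y - psi q| <= L * `|y - q| by near: y.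
  have h1 : `|u (psi y) - u (psi q) - dot g (psi y - psi q)| <= e1 * `|psi y - psi q|.
    by move: (chart_in hp Uy); near: y.
  have h2 : `|psi y - psi q - 'd psi q (y - q)| <= e2 * `|y - q| by near: y.
  rewrite dfE /=; rewrite -deriveE// in h2; set A := 'D_(y - q) psi q in h2 *.
  have -> : u (psi y) - u (psi q) - dot g A =
    (u (psi y) - u (psi q) - dot g (psi y - psi q)) + dot g (psi y - psi q - A).
    by rewrite (dotBr _ A); ring.
  apply: (le_trans (ler_normD _ _)).
  have h3 := dot_le g (psi y - psi q - A).
  have -> : e * `|y - q| = e / 2 * `|y - q| + e / 2 * `|y - q| by field.
  apply: lerD.
    apply: (le_trans h1); apply: (le_trans (ler_wpM2l (ltW e10) yL)).
    by rewrite /e1 le_eqVlt; apply/orP; left; apply/eqP; field; rewrite gt_eqF.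
  apply: (le_trans h3); apply: (@le_trans _ _ (3 * ((`|g| + 1) * (e2 * `|y - q|)))).
    rewrite ler_pM2l//; apply: ler_pM => //; by rewrite lerDl.
  by rewrite /e2 le_eqVlt; apply/orP; left; apply/eqP; field; rewrite gt_eqF.
by split=> // v; rewrite deriveE// dE dfE.
Unshelve. all: by end_near. Qed.

Lemma is_surface_grad_first_order u x g : is_surface_grad Gamma u x g -> first_order u x g.
Proof. by move=> [U [psi [q [hp Uq <- _ [du hD]]]]]; exact: (chart_first_order hp Uq du hD). Qed.

(* The difference of the two gradients is orthogonal to both of them. *)
Lemma is_surface_grad_unique u x g1 g2 :
  is_surface_grad Gamma u x g1 -> is_surface_grad Gamma u x g2 -> g1 = g2.
Proof.
move=> h1 h2; have f1 := is_surface_grad_first_order h1.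
have f2 := is_surface_grad_first_order h2.
have key g : is_surface_grad Gamma u x g -> dot g1 g = dot g2 g.
  move=> [U [psi [q [hp Uq qx [v ->] _]]]]; rewrite -qx in f1 f2.
  have [_ <-] := first_order_chart hp Uq f1; have [_ <-] := first_order_chart hp Uq f2.
  by [].
apply/eqP; rewrite -subr_eq0; apply/eqP/dot_eq0.
by rewrite dotBr !dotBl (key _ h1) (key _ h2) !subrr.
Qed.

(** The vector g may have a normal component; its orthogonal projection onto the tangent plane has
    the same inner products with tangent vectors. *)
Lemma first_order_surface_grad U psi q u g : local_param Gamma U psi -> U q ->
  first_order u (psi q) g -> exists w, is_surface_grad Gamma u (psi q) ('D_w psi q).
Proof.
move=> hp Uq fo; have dp := chart_differentiable hp Uq.
have [du hD] := first_order_chart hp Uq fo.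
exists (tangent_sol psi q (dot g ('D_(1, 0) psi q)) (dot g ('D_(0, 1) psi q))).
exists U, psi, q; split=> //; first by eexists.
split=> // v; rewrite hD; apply/esym.
exact: (tangent_solP _ dp (chart_gram_gt0 hp Uq)).
Qed.

(** By definition a surface gradient is tangent in some chart; uniqueness makes it tangent in any
    given one. *)
Lemma is_surface_grad_chart U psi q u g : local_param Gamma U psi -> U q ->
  is_surface_grad Gamma u (psi q) g ->
  exists w, g = 'D_w psi q.
Proof.
move=> hp Uq hg; have [w hw] := first_order_surface_grad hp Uq (is_surface_grad_first_order hg).
by exists w; exact: is_surface_grad_unique hw.
Qed.

Lemma chart_surface_grad U psi q u w : local_param Gamma U psi -> U q ->
  first_order u (psi q) ('D_w psi q) -> is_surface_grad Gamma u (psi q) ('D_w psi q).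
Proof.
move=> hp Uq fo; have [du hD] := first_order_chart hp Uq fo.
by exists U, psi, q; split=> //; exists w.
Qed.

Lemma surface_gradE u x g : is_surface_grad Gamma u x g -> surface_grad Gamma u x = g.
Proof.
move=> h; apply: (@is_surface_grad_unique u x) => //.
exact: (@xgetPex _ 0 [set g | is_surface_grad Gamma u x g] (ex_intro _ g h)).
Qed.

Lemma first_orderD u v (c : R) x g h : first_order u x g -> first_order v x h ->
  first_order (u + c *: v) x (g + c *: h).
Proof.
move=> fu fv e e0; pose e1 := e / (2 * (`|c| + 1)).
have c1 : 0 < `|c| + 1 by rewrite ltr_wpDl.
have e10 : 0 < e1 by rewrite divr_gt0// mulr_gt0.
have n1 := fu (e / 2) (divr_gt0 e0 (ltr0Sn _ 1)); have n2 := fv _ e10.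
near=> y => Gy.
have h1 : `|u y - u x - dot g (y - x)| <= e / 2 * `|y - x| by move: Gy; near: y.
have h2 : `|v y - v x - dot h (y - x)| <= e1 * `|y - x| by move: Gy; near: y.
have -> : (u + c *: v) y - (u + c *: v) x - dot (g + c *: h) (y - x) =
  (u y - u x - dot g (y - x)) + c * (v y - v x - dot h (y - x)).
  by rewrite dotDl dotZl !fctE /GRing.scale/=; ring.
apply: (le_trans (ler_normD _ _)).
have -> : e * `|y - x| = e / 2 * `|y - x| + e / 2 * `|y - x| by field.
apply: lerD => //; rewrite normrM.
apply: (@le_trans _ _ ((`|c| + 1) * (e1 * `|y - x|))).
  by apply: ler_pM => //; by rewrite lerDl.
by rewrite /e1 le_eqVlt; apply/orP; left; apply/eqP; field; rewrite gt_eqF.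
Unshelve. all: by end_near. Qed.

(** Expansions add up; tangency of the sum becomes visible once both gradients are written in the
    same chart. *)
Lemma is_surface_gradD u v (c : R) x g h :
  is_surface_grad Gamma u x g -> is_surface_grad Gamma v x h ->
  is_surface_grad Gamma (u + c *: v) x (g + c *: h).
Proof.
move=> hu hv; have [U [psi [q [hp Uq qx _ _]]]] := hu; rewrite -qx in hu hv *.
have [w gw] := is_surface_grad_chart hp Uq hu.
have [z hz] := is_surface_grad_chart hp Uq hv.
have dp := chart_differentiable hp Uq.
have E : g + c *: h = 'D_(w + c *: z) psi q.
  by rewrite gw hz !deriveE// linearD linearZ.
have fo := first_orderD c (is_surface_grad_first_order hu) (is_surface_grad_first_order hv).
by rewrite E in fo *; exact: (chart_surface_grad hp Uq fo).
Qed.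

End gradients.

Lemma cvg_gram (R : realType) (T : topologicalType) (F : set_system T) (FF : Filter F)
    (a b : T -> R3 R) (a0 b0 : R3 R) : a @ F --> a0 -> b @ F --> b0 ->
  dot (a y) (a y) * dot (b y) (b y) - dot (a y) (b y) ^+ 2 @[y --> F] -->
  dot a0 a0 * dot b0 b0 - dot a0 b0 ^+ 2.
Proof.
move=> ca cb; have caa := cvg_dot FF ca ca; have cbb := cvg_dot FF cb cb.
have cab := cvg_dot FF ca cb.
by rewrite expr2; under eq_fun do rewrite expr2; exact: (cvgB (cvgM caa cbb) (cvgM cab cab)).
Qed.

Lemma subset_setU_measure0 d (T : measurableType d) (R : realType)
    (mu : {measure set T -> \bar R}) (A B W : set T) :
  measurable A -> measurable B -> measurable W -> mu A = 0%E -> mu B = 0%E ->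
  W `<=` A `|` B -> mu W = 0%E.
Proof.
move=> mA mB mW A0 B0 WAB; apply: (subset_measure0 mW (measurableU _ _ mA mB) WAB).
exact: (etrans (measureU0 mA mB B0) A0).
Qed.

Lemma zero_gradient_null (R : realType) (U W : set (R2 R)) (g : R2 R -> R) :
  open U -> C1 U g -> measurable W ->
  (forall q, W q -> [/\ U q, g q = 0 & 'D_(1, 0) g q != 0 \/ 'D_(0, 1) g q != 0]) ->
  lebesgue2 W = 0%E.
Proof.
move=> oU hg mW hW.
have n1 := zero_slope_null1 oU hg; have n2 := zero_slope_null2 oU hg.
have m1 := zero_slope_measurable (1, 0) oU hg; have m2 := zero_slope_measurable (0, 1) oU hg.
apply: (@subset_setU_measure0 _ _ _ lebesgue2 _ _ W m1 m2 mW n1 n2).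
by move=> q /hW[Uq gq [h|h]]; [left|right].
Qed.

Lemma cvg_tangent_proj (R : realType) (T : topologicalType) (F : set_system T) (FF : Filter F)
    (a b w : T -> R3 R) (a0 b0 w0 : R3 R) :
  a @ F --> a0 -> b @ F --> b0 -> w @ F --> w0 ->
  0 < dot a0 a0 * dot b0 b0 - dot a0 b0 ^+ 2 ->
  lin2 (a y) (b y) (gram_sol (a y) (b y) (dot (w y) (a y)) (dot (w y) (b y))) @[y --> F] -->
  lin2 a0 b0 (gram_sol a0 b0 (dot w0 a0) (dot w0 b0)).
Proof.
move=> ca cb cg g0.
have cga := cvg_dot FF cg ca; have cgb := cvg_dot FF cg cb.
have caa := cvg_dot FF ca ca; have cbb := cvg_dot FF cb cb; have cab := cvg_dot FF ca cb.
have cgram := cvg_gram FF ca cb.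
have := cvgV (lt0r_neq0 g0) cgram; move=> /(_ FF) civ.
have c1 := cvgM (cvgB (cvgM cbb cga) (cvgM cab cgb)) civ.
have c2 := cvgM (cvgB (cvgM caa cgb) (cvgM cab cga)) civ.
move: (c1 FF FF FF FF) (c2 FF FF FF FF) => {}c1 {}c2.
exact: (cvgD (cvgZ c1 ca) (cvgZ c2 cb)).
Qed.

Section gradients_on_surface.
Context {R : realType}.
Variable Gamma : set (R3 R).
Hypothesis sG : smooth_surface Gamma.

Lemma surface_chart x : Gamma x -> exists U psi q, [/\ local_param Gamma U psi, U q & psi q = x].
Proof. by move=> /sG[U [psi [hp [q Uq qx]]]]; exists U, psi, q. Qed.

Lemma differentiable_first_order (p : R3 R -> R) x : differentiable p x ->
  first_order Gamma p x (grad3 p x).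
Proof.
move=> dp e e0; have := differentiable_le dp e0; apply: filterS => y h _.
by rewrite -grad3E// deriveE.
Qed.

Lemma surface_grad_tangent (p : R3 R -> R) U psi q : C1 setT p ->
  local_param Gamma U psi -> U q ->
  is_surface_grad Gamma p (psi q) (surface_grad Gamma p (psi q)).
Proof.
move=> hp hU Uq; have [dp _] := hp (psi q) I.
have [w hw] := first_order_surface_grad hU Uq (differentiable_first_order dp).
by rewrite (surface_gradE hw).
Qed.

Lemma C1_is_surface_grad (p : R3 R -> R) x : C1 setT p -> Gamma x ->
  is_surface_grad Gamma p x (surface_grad Gamma p x).
Proof. by move=> hp /surface_chart[U [psi [q [hU Uq <-]]]]; exact: surface_grad_tangent hU Uq. Qed.

(** The projection of the ambient gradient onto the tangent plane, as an explicit function of the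
    parameter whose continuity can be checked. *)
Definition chart_grad (p : R3 R -> R) (psi : R2 R -> R3 R) (q : R2 R) : R3 R :=
  let a := 'D_(1, 0) psi q in let b := 'D_(0, 1) psi q in
  lin2 a b (gram_sol a b (dot (grad3 p (psi q)) a) (dot (grad3 p (psi q)) b)).

Lemma surface_grad_chart (p : R3 R -> R) U psi q : C1 setT p ->
  local_param Gamma U psi -> U q -> surface_grad Gamma p (psi q) = chart_grad p psi q.
Proof.
move=> hp hU Uq; have [dp _] := hp (psi q) I; have dpsi := chart_differentiable hU Uq.
have [du hD] := first_order_chart hU Uq (differentiable_first_order dp).
rewrite /chart_grad -derive_lin2//; apply: surface_gradE.
exists U, psi, q; split=> //; first by eexists.
split=> // v; rewrite hD; apply/esym.
exact: (tangent_solP _ dpsi (chart_gram_gt0 hU Uq)).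
Qed.

Lemma chart_grad_continuous (p : R3 R -> R) U psi q : C1 setT p ->
  local_param Gamma U psi -> U q -> {for q, continuous (chart_grad p psi)}.
Proof.
move=> hp hU Uq; have [dpsi cD] := chart_C1 hU Uq.
have cp : psi @ q --> psi q := differentiable_continuous dpsi.
have cg := cvg_comp psi (grad3 p) cp (@grad3_continuous _ _ hp (psi q)).
exact: (cvg_tangent_proj (nbhs_filter q) (cD (1, 0)) (cD (0, 1)) cg (chart_gram_gt0 hU Uq)).
Qed.

Lemma surface_grad_continuous (p : R3 R -> R) : C1 setT p ->
  {within Gamma, continuous (surface_grad Gamma p)}.
Proof.
move=> hp; apply/subspace_continuousP => x Gx.
have [U [psi [q [hU Uq qx]]]] := surface_chart Gx; rewrite -qx.
move=> A nA0; have nA : nbhs (chart_grad p psi q) A by rewrite -(surface_grad_chart hp hU Uq).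
have nF := chart_grad_continuous hp hU Uq nA.
have m1 := chart_inv_continuous hU Uq nF; have m2 := chart_image hU Uq.
suff : \forall y \near psi q, Gamma y -> A (surface_grad Gamma p y) by [].
near=> y => Gy.
have [z Uz zy] : exists2 z, U z & psi z = y by move: Gy; near: y.
rewrite -zy (surface_grad_chart hp hU Uz).
by move: (z) Uz zy; near: y.
Unshelve. all: by end_near. Qed.

(** The pieces are closed and finitely many, so near x only those containing x occur, and these
    share one expansion. *)
Lemma piecewise_first_order (I : finType) (F : I -> set (R3 R)) (p : I -> R3 R -> R) u x g :
  (forall i, closed (F i)) -> (forall y, Gamma y -> exists i, F i y) ->
  (forall i y, F i y -> Gamma y -> u y = p i y) -> Gamma x ->
  (forall i, F i x -> first_order Gamma (p i) x g) -> first_order Gamma u x g.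
Proof.
move=> cF covF uF Gx fo e e0.
(* The clause [F i x] says that a piece met near x contains x; for the other pieces the premise
   [F i y] fails near x. *)
pose P i y := Gamma y -> F i y -> F i x /\ `|p i y - p i x - dot g (y - x)| <= e * `|y - x|.
have : \forall y \near x, forall i, P i y.
  apply: (@filter_forall _ I P (nbhs x) (nbhs_filter x)) => i.
  have [Fx|nFx] := pselect (F i x).
    by have := fo i Fx e e0; apply: filterS => y h Gy _; split=> //; exact: h.
  have : nbhs x (~` F i) by apply: open_nbhs_nbhs; split=> //; exact: closed_openC.
  by apply: filterS.
apply: filterS => y h Gy; have [i Fy] := covF _ Gy; have [Fx hi] := h i Gy Fy.
by rewrite (uF i y)// (uF i x).
Qed.

Lemma first_order_ext u v x g : (forall y, Gamma y -> u y = v y) -> Gamma x ->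
  first_order Gamma u x g -> first_order Gamma v x g.
Proof.
by move=> uv Gx fo e e0; have := fo e e0; apply: filterS => y h Gy; rewrite -!uv//; exact: h.
Qed.

(** What is taken from u is the tangency of g at x; the expansion comes from v. *)
Lemma tangent_surface_grad u v x g : is_surface_grad Gamma u x g ->
  first_order Gamma v x g -> is_surface_grad Gamma v x g.
Proof.
move=> [U [psi [q [hp Uq qx [w gw] _]]]] fo.
by rewrite -qx gw in fo *; exact: (chart_surface_grad hp Uq fo).
Qed.

Lemma is_surface_grad_Gamma u x g : is_surface_grad Gamma u x g -> Gamma x.
Proof. by move=> [U [psi [q [hp Uq <- _ _]]]]; exact: chart_in hp Uq. Qed.

Lemma is_surface_grad_ext u v x g : (forall y, Gamma y -> u y = v y) ->
  is_surface_grad Gamma u x g -> is_surface_grad Gamma v x g.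
Proof.
move=> uv hu; apply: (tangent_surface_grad hu).
exact: (first_order_ext uv (is_surface_grad_Gamma hu) (is_surface_grad_first_order hu)).
Qed.

Lemma surface_grad_ext u v x : (forall y, Gamma y -> u y = v y) ->
  surface_grad Gamma u x = surface_grad Gamma v x.
Proof.
move=> uv; rewrite /surface_grad; congr (xget 0 _); apply/seteqP.
by split=> g /=; apply: is_surface_grad_ext => // y /uv.
Qed.

Lemma surface_grad0 u x : (forall y, Gamma y -> u y = 0) -> surface_grad Gamma u x = 0.
Proof.
move=> u0; have [Gx|nGx] := pselect (Gamma x); last first.
  (* Off Gamma no vector is a surface gradient, and [xget] returns its default 0. *)
  by apply: xgetPN => g /is_surface_grad_Gamma.
apply: surface_gradE; apply: (@is_surface_grad_ext (cst 0)) => [y /u0//|].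
have [U [psi [q [hU Uq <-]]]] := surface_chart Gx.
have <- := derive0 psi q; apply: (chart_surface_grad hU Uq).
by move=> e e0; near=> y => _; rewrite derive0 dot0l /= !subrr normr0 mulr_ge0// ltW.
Unshelve. all: by end_near. Qed.

Lemma piecewise_surface_grad (I : finType) (F : I -> set (R3 R)) (p : I -> R3 R -> R) u x :
  (forall i, closed (F i)) -> (forall y, Gamma y -> exists i, F i y) ->
  (forall i, C1 setT (p i)) ->
  (forall i y, F i y -> Gamma y -> u y = p i y) -> Gamma x ->
  (forall i j, F i x -> F j x -> surface_grad Gamma (p i) x = surface_grad Gamma (p j) x) ->
  forall i, F i x -> is_surface_grad Gamma u x (surface_grad Gamma (p i) x).
Proof.
move=> cF covF hp uF Gx E i Fx; have hi := C1_is_surface_grad (hp i) Gx.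
apply: (tangent_surface_grad hi); apply: (piecewise_first_order cF covF uF Gx) => j Fjx.
by rewrite (E i j)//; apply: is_surface_grad_first_order; exact: C1_is_surface_grad.
Qed.

End gradients_on_surface.

(** * The surface measure *)

(** Passage to a finite subcover as an induction principle: a property of sets that is stable under
    unions and subsets and holds locally on a compact set holds for the whole set. *)
Lemma compact_local_ind (T : topologicalType) (A : set T) (P : set T -> Prop) :
  compact A -> P set0 -> (forall X Y, P X -> P Y -> P (X `|` Y)) ->
  (forall X Y, Y `<=` X -> P X -> P Y) ->
  (forall x, A x -> exists V, [/\ open V, V x & P (A `&` V)]) -> P A.
Proof.
move=> /compact_near_coveringP cA P0 PU PS h.
(* A statement holds along [F] when it holds for all supersets of some set with [P]; stability under
   unions makes this a filter. *)
pose F : set_system (set T) := [set S | exists2 X0, P X0 & forall X, X0 `<=` X -> S X].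
have FF : Filter F.
  split.
  - by exists set0.
  - move=> S1 S2 [X1 p1 h1] [X2 p2 h2]; exists (X1 `|` X2); first exact: PU.
    by move=> X hX; split; [apply: h1|apply: h2] => x Xx; apply: hX; [left|right].
  - by move=> S1 S2 S12 [X1 p1 h1]; exists X1 => // X /h1/S12.
have [x Ax|X PX hX] := cA _ F (fun X x => A x -> X x) FF.
  have [V [oV Vx PV]] := h x Ax.
  exists (V, [set X | A `&` V `<=` X]) => /=.
    split; first by apply: open_nbhs_nbhs.
    by exists (A `&` V).
  by move=> [y X] [/= Vy VX] Ay; exact: VX.
by apply: (PS _ _ _ PX) => x Ax; exact: (hX X (fun _ => id) x Ax Ax).
Qed.

Lemma measure_setI_full d (T : measurableType d) (R : realType)
    (mu : {measure set T -> \bar R}) (A G : set T) :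
  measurable A -> measurable G -> mu (~` G) = 0%E -> mu (A `&` G) = mu A.
Proof.
move=> mA mG G0; rewrite -[in RHS](setUIDK A G) measureU//.
- rewrite [X in (_ + X)%E](_ : _ = 0%E) ?adde0//.
  apply/eqP; rewrite eq_le measure_ge0 andbT -G0.
  apply: le_measure; rewrite ?inE.
  - exact: measurableD.
  - exact: measurableC.
  - by move=> x [].
- exact: measurableI.
- exact: measurableD.
- by rewrite setDE setIACA setICr setI0.
Qed.

Section surface_measure_theory.
Context {R : realType}.
Variables (Gamma : set (R3 R)) (sigma : {measure set (R3 R) -> \bar R}).
Hypothesis cG : compact Gamma.
Hypothesis sG : smooth_surface Gamma.
Hypothesis hsigma : surface_measure Gamma sigma.

Lemma Gamma_closed : closed Gamma.
Proof. by apply: compact_closed => //; exact: norm_hausdorff. Qed.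

Lemma Gamma_measurable : measurable Gamma.
Proof. exact: closed_measurable3 Gamma_closed. Qed.

Lemma sigma_setI A : measurable A -> sigma (A `&` Gamma) = sigma A.
Proof.
move=> mA; apply: measure_setI_full => //; first exact: Gamma_measurable.
by case: hsigma.
Qed.

Lemma chart_measurable U psi : local_param Gamma U psi -> measurable (psi @` U).
Proof.
move=> [oU _ _ _ hO]; have [V oV E] := hO setT openT.
by rewrite setIT in E; rewrite E; apply: measurableI; [exact: Gamma_measurable|exact: open_measurable3].
Qed.

Lemma chart_open U psi Q : local_param Gamma U psi -> open Q ->
  exists V, [/\ open V, (forall y, U y -> Q y -> V (psi y)) &
    forall x, Gamma x -> V x -> exists2 y, U y /\ Q y & psi y = x].
Proof.
move=> [oU _ _ _ hO] /hO[V oV E]; exists V; split=> //.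
- move=> y Uy Qy; suff : (Gamma `&` V) (psi y) by case.
  by rewrite -E; exists y.
- move=> x Gx Vx; suff : (psi @` (U `&` Q)) x by case=> y ? <-; exists y.
  by rewrite E.
Qed.

Lemma area_density_continuous U psi q : local_param Gamma U psi -> U q ->
  {for q, continuous (area_density psi)}.
Proof.
move=> hU Uq; have [_ cD] := chart_C1 hU Uq.
have FF : Filter (nbhs q) := nbhs_filter q.
have ca := cD (1, 0); have cb := cD (0, 1).
apply: (cvg_comp (gram psi) Num.sqrt _ (@sqrt_continuous R (gram psi q))).
exact: (cvg_gram FF ca cb).
Qed.

Lemma area_density_measurable U psi : local_param Gamma U psi ->
  measurable_fun U (area_density psi).
Proof.
move=> hU; have oU : open U by case: hU.
apply: within_measurable2; first exact: open_measurable2.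
by apply: continuous_in_subspaceT => q /set_mem Uq; exact: (area_density_continuous hU Uq).
Qed.

(** Coordinatewise: each coordinate of psi, extended by zero off U, is measurable on the whole
    plane, and the triple of these extensions agrees with psi on U. *)
Lemma chart_preimage_measurable U psi A : local_param Gamma U psi -> measurable A ->
  measurable (U `&` psi @^-1` A).
Proof.
move=> hU mA; have oU : open U by case: hU.
have cpsi q : U q -> psi @ q --> psi q.
  by move=> Uq; exact: (differentiable_continuous (chart_differentiable hU Uq)).
have mU := open_measurable2 oU.
have m (f : R3 R -> R) : continuous f -> measurable_fun U (f \o psi).
  move=> cf; apply: within_measurable2 => //.
  apply: continuous_in_subspaceT => q /set_mem Uq.
  exact: (cvg_comp psi f (cpsi _ Uq) (cf (psi q))).
pose r i := (coordL (inord i) \o psi : R2 R -> R) \_ U.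
pose psi' q := ((r 0 q, r 1 q), r 2 q).
have mp : measurable_fun setT psi'.
  have mr i : measurable_fun setT (r i).
    exact: (iffLR (measurable_restrictT _ mU) (m _ (@coord_continuous R (inord i)))).
  by apply: measurable_fun_pair => //; exact: measurable_fun_pair.
suff -> : U `&` psi @^-1` A = U `&` (setT `&` psi' @^-1` A).
  by apply: measurableI => //; exact: mp.
apply/seteqP; suff E q : U q -> psi' q = psi q by split=> q [Uq] => [|[_]] Aq; split=> //=; [rewrite E|rewrite -E].
move=> Uq; rewrite /psi' /r !patchE (mem_set Uq) /coordL /Defs.coord/= !inordK//.
by case: (psi q) => -[].
Qed.

Lemma sigma_chart_null U psi Z : local_param Gamma U psi -> measurable Z ->
  lebesgue2 (U `&` psi @^-1` Z) = 0%E -> sigma (Z `&` psi @` U) = 0%E.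
Proof.
move=> hU mZ h0; have [_ /(_ _ _ hU _ mZ) ->] := hsigma.
have oU : open U by case: hU.
apply: null_set_integral => //; first exact: (chart_preimage_measurable hU mZ).
apply/measurable_EFinP; apply: (measurable_funS (open_measurable2 oU)); first by move=> ? [].
exact: area_density_measurable.
Qed.

Lemma sigma_null Z : measurable Z ->
  (forall U psi, local_param Gamma U psi -> lebesgue2 (U `&` psi @^-1` Z) = 0%E) ->
  sigma Z = 0%E.
Proof.
move=> mZ h; rewrite -sigma_setI//.
(* Asking only for a measurable superset makes [P] pass to arbitrary subsets, as the compactness
   argument requires. *)
pose P X := exists N, [/\ measurable N, X `<=` N & sigma (Z `&` N) = 0%E].
suff [N [mN GN N0]] : P Gamma.
  apply/eqP; rewrite eq_le measure_ge0 andbT -N0; apply: le_measure; rewrite ?inE.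
  - by apply: measurableI => //; exact: Gamma_measurable.
  - exact: measurableI.
  - by apply: setIS.
refine (@compact_local_ind _ Gamma P cG _ _ _ _).
- by exists set0; split=> //; rewrite setI0 measure0.
- move=> X Y [N1 [m1 s1 z1]] [N2 [m2 s2 z2]]; exists (N1 `|` N2).
  split; [exact: measurableU|exact: setUSS|].
  by rewrite setIUr; apply: (etrans (measureU0 _ _ z2) z1); exact: measurableI.
- by move=> X Y YX [N [mN XN zN]]; exists N; split=> //; exact: subset_trans XN.
move=> x Gx; have [U [psi [q [hU Uq qx]]]] := surface_chart sG Gx.
have [V [oV UV VU]] := chart_open hU openT.
exists V; split=> //; first by rewrite -qx; exact: UV.
exists (psi @` U); split; first exact: (chart_measurable hU).
  by move=> y [Gy Vy]; have [z [Uz _] <-] := VU y Gy Vy; exists z.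
by apply: sigma_chart_null => //; exact: h.
Qed.

(** In a chart at x the measure is the integral of a positive density over a neighbourhood of q.
    Were it zero, this neighbourhood would be Lebesgue null, although it contains a nonempty open
    set. *)
Lemma sigma_open_gt0 O x : open O -> O x -> Gamma x -> (0 < sigma (Gamma `&` O))%E.
Proof.
move=> oO Ox Gx; have [U [psi [q [hU Uq qx]]]] := surface_chart sG Gx.
have mO := open_measurable3 oO.
rewrite setIC sigma_setI// lt0e measure_ge0 andbT; apply/eqP => O0.
have s0 : sigma (O `&` psi @` U) = 0%E.
  apply/eqP; rewrite eq_le measure_ge0 andbT -O0; apply: le_measure; rewrite ?inE//.
  by apply: measurableI => //; exact: (chart_measurable hU).
have [_ hf] := hsigma; have := hf _ _ hU _ mO; rewrite s0 => /esym i0.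
set W := U `&` psi @^-1` O in i0.
have mW : measurable W by exact: (chart_preimage_measurable hU mO).
have oU : open U by case: hU.
have nW : nbhs q W.
  apply: filterI; first exact: open_nbhs_nbhs.
  have cp := differentiable_continuous (chart_differentiable hU Uq).
  by apply: cp; apply: open_nbhs_nbhs; rewrite qx.
have mf : measurable_fun W (EFin \o area_density psi).
  apply/measurable_EFinP; apply: (measurable_funS (open_measurable2 oU)); first by move=> ? [].
  exact: area_density_measurable.
have dpos y : W y -> 0 < area_density psi y by case: hU => _ _ _ h _ [Uy _]; exact: h.
have i1 : (\int[lebesgue2]_(y in W) `|(area_density psi y)%:E|)%E = 0%E.
  rewrite -[RHS]i0; apply: eq_integral => y; rewrite inE => Wy.
  by rewrite gee0_abs// lee_fin ltW// dpos.
have [N [mN N0 sN]] := iffLR (@ae_eq_integral_abs _ _ _ lebesgue2 W mW (EFin \o area_density psi) mf) i1.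
have WN : W `<=` N.
  by move=> y Wy; apply: sN => /= /(_ Wy) []; apply/eqP; rewrite gt_eqF// dpos.
have : (0 < lebesgue2 (interior W))%E.
  by apply: lebesgue2_open_gt0; [exact: open_interior|exists q].
rewrite lt0e measure_ge0 andbT => /eqP; apply; apply/eqP.
rewrite eq_le measure_ge0 andbT -N0; apply: le_measure; rewrite ?inE//.
  by apply: open_measurable2; exact: open_interior.
exact: subset_trans (@interior_subset _ W) WN.
Qed.

Lemma lebesgue2_base_fin i : (lebesgue2 (@base2 R i) < +oo)%E.
Proof.
have fin (j : rat * rat) : exists r : R, lebesgue_measure (rat_itv j : set R) = r%:E.
  by rewrite /rat_itv lebesgue_measure_itv/=; case: ifP => _; [rewrite -EFinB|]; eexists.
rewrite /base2 lebesgue2X; have [r1 ->] := fin i.1; have [r2 ->] := fin i.2.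
by rewrite -EFinM ltry.
Qed.

(** Locally the density is bounded on a rational box, which has finite area; compactness of Gamma
    makes finitely many such pieces suffice. *)
Lemma sigma_Gamma_fin : (sigma Gamma < +oo)%E.
Proof.
pose P X := exists N, [/\ measurable N, X `<=` N & (sigma N < +oo)%E].
suff [N [mN GN Nfin]] : P Gamma.
  apply: le_lt_trans Nfin; apply: le_measure; rewrite ?inE//; exact: Gamma_measurable.
refine (@compact_local_ind _ Gamma P cG _ _ _ _).
- by exists set0; split=> //; rewrite measure0.
- move=> X Y [N1 [m1 s1 z1]] [N2 [m2 s2 z2]]; exists (N1 `|` N2).
  split; [exact: measurableU|exact: setUSS|].
  apply: (@le_lt_trans _ _ (sigma N1 + sigma N2)%E); first exact: measureU2.
  exact: lte_add_pinfty.
- by move=> X Y YX [N [mN XN zN]]; exists N; split=> //; exact: subset_trans XN.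
move=> x Gx; have [U [psi [q [hU Uq qx]]]] := surface_chart sG Gx.
have oU : open U by case: hU.
pose M := area_density psi q + 1.
have M0 : 0 <= M by rewrite addr_ge0// sqrtr_ge0.
have nM : \forall y \near q, U y /\ area_density psi y <= M.
  have nU : \forall y \near q, U y by exact: open_nbhs_nbhs.
  have /cvgrPdist_le/(_ _ ltr01) nD := area_density_continuous hU Uq.
  near=> y; split; first by near: y.
  have : `|area_density psi q - area_density psi y| <= 1 by near: y.
  by rewrite ler_distl => /andP[h1 _]; rewrite /M -lerBlDr.
have [i iq iM] := nbhs_baseX rat_itv_base rat_itv_base nM.
set B := rat_itv i.1 `*` rat_itv i.2 in iq iM.
have mB : measurable B by apply: measurableX; exact: measurable_rat_itv.
have oB : open B.
  rewrite openE => -[x1 x2] [/= B1 B2]; exists (rat_itv i.1, rat_itv i.2) => //=.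
  by split; apply: open_nbhs_nbhs; split=> //; exact: interval_open.
have [V [oV UV VU]] := chart_open hU oB.
have inj : set_inj U psi by case: hU.
have BU y : B y -> U y by move=> /iM[].
exists V; split=> //; first by rewrite -qx; apply: UV.
have mV := open_measurable3 oV.
exists (V `&` psi @` U); split.
- by apply: measurableI => //; exact: (chart_measurable hU).
- by move=> y [Gy Vy]; have [z [Uz _] zy] := VU y Gy Vy; split=> //; exists z.
have [_ /(_ _ _ hU _ mV) ->] := hsigma.
(* Injectivity of the chart ensures that no parameter outside the box is sent into [V]. *)
have -> : U `&` psi @^-1` V = B.
  apply/seteqP; split=> y.
    move=> [Uy Vy]; have [z [Uz Bz] zy] := VU _ (chart_in hU Uy) Vy.
    by rewrite (_ : y = z)//; apply: inj; rewrite ?inE.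
  by move=> By; split; [exact: BU|apply: UV => //; exact: BU].
apply: (@le_lt_trans _ _ (\int[lebesgue2]_(y in B) (cst M%:E) y)%E).
  apply: ge0_le_integral => //.
  - by move=> y By; rewrite lee_fin sqrtr_ge0.
  - apply/measurable_EFinP; apply: (measurable_funS (open_measurable2 oU)).
      by move=> y /iM[].
    exact: area_density_measurable.
  - by move=> y By; rewrite lee_fin; have [] := iM _ By.
rewrite integral_cst//; apply: lte_mul_pinfty; rewrite ?lee_fin//.
exact: (lebesgue2_base_fin i).
Unshelve. all: by end_near. Qed.

Lemma sigmaT_fin : (sigma setT < +oo)%E.
Proof. by rewrite -sigma_setI// setTI sigma_Gamma_fin. Qed.

Lemma coincidence_null (p1 p2 : R3 R -> R) : C1 setT p1 -> C1 setT p2 ->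
  let Z := [set x | [/\ Gamma x, p1 x = p2 x &
    surface_grad Gamma p1 x <> surface_grad Gamma p2 x]] in
  measurable Z /\ sigma Z = 0%E.
Proof.
move=> hp1 hp2 Z.
have C1c (p : R3 R -> R) : C1 setT p -> continuous p.
  by move=> hp x; have [dp _] := hp x I; exact: differentiable_continuous.
have mG := Gamma_measurable.
have mZ : measurable Z.
  (* The squared length of [d] is continuous on Gamma, and Z is the part of Gamma where it is
     nonzero and p1 - p2 vanishes. *)
  pose d x := surface_grad Gamma p1 x - surface_grad Gamma p2 x.
  have cd : {within Gamma, continuous d}.
    by move=> x; apply: cvgB; exact: surface_grad_continuous.
  have m1 : measurable_fun Gamma (fun x => dot (d x) (d x)).
    by apply: within_measurable3 => // x; apply: cvg_dot; exact: cd.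
  have m2 : measurable_fun Gamma (fun x => p1 x - p2 x).
    apply: within_measurable3 => //; apply: continuous_subspaceT => x.
    by apply: cvgB; exact: C1c.
  have -> : Z = (Gamma `&` (fun x => p1 x - p2 x) @^-1` [set 0]) `&`
     (Gamma `&` (fun x => dot (d x) (d x)) @^-1` (~` [set 0])).
    apply/seteqP; split=> x /=.
      move=> [Gx p12 dne]; split; split=> //; first by rewrite p12 subrr.
      by move=> /dot_eq0/eqP; rewrite subr_eq0 => /eqP.
    move=> [[Gx p12] [_ dne]]; split=> //; first by apply/eqP; rewrite -subr_eq0 p12.
    by move=> h; apply: dne; rewrite /d h subrr dot0l.
  by apply: measurableI; [exact: m2|apply: m1 => //; exact: measurableC].
split=> //; apply: sigma_null => // U psi hU.
have oU : open U by case: hU.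
have hpsi := chart_C1 hU.
have [g1 D1] := C1_comp oU hpsi hp1; have [g2 D2] := C1_comp oU hpsi hp2.
pose g := fun q => (p1 \o psi) q + (-1) * (p2 \o psi) q.
have hg : C1 U g := C1D oU g1 (C1M oU (@C1_cst R _ R U (-1)) g2).
apply: (zero_gradient_null oU hg); first exact: (chart_preimage_measurable hU mZ).
move=> q [Uq [Gq p12 dne]].
have gq : g q = 0 by rewrite /g/= p12 mulN1r subrr.
split=> //; have [h1|h1] := eqVneq ('D_(1, 0) g q) 0; last by left.
right; apply/eqP => h2; apply: dne.
rewrite (surface_grad_chart hp1 hU Uq) (surface_grad_chart hp2 hU Uq) /chart_grad.
have [dg1 _] := g1 _ Uq; have [dg2 _] := g2 _ Uq.
(* If both partial derivatives of g vanished, the ambient gradients of p1 and p2 would have the same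
   inner products with the tangent basis, hence the same projection. *)
have Dg v : 'D_v g q = 0 -> dot (grad3 p1 (psi q)) ('D_v psi q) = dot (grad3 p2 (psi q)) ('D_v psi q).
  move=> Dg0; rewrite -D1// -D2//; apply/eqP; rewrite -subr_eq0; apply/eqP.
  rewrite -[RHS]Dg0 /g.
  have -> : (fun q => (p1 \o psi) q + (-1) * (p2 \o psi) q) = (p1 \o psi) - (p2 \o psi).
    by apply: funext => z; rewrite !fctE/= mulN1r.
  by rewrite deriveB//; exact: diff_derivable.
exact: (congr2 (fun c1 c2 => lin2 _ _ (gram_sol _ _ c1 c2)) (Dg _ h1) (Dg _ h2)).
Qed.

End surface_measure_theory.

Lemma bigcup_null d (T : measurableType d) (R : realType) (mu : {measure set T -> \bar R})
    (I : countType) (F : I -> set T) (W : set T) :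
  (forall i, measurable (F i) /\ mu (F i) = 0%E) -> measurable W ->
  W `<=` \bigcup_i F i -> mu W = 0%E.
Proof.
move=> hF mW WF; apply: measure_negligible => //.
pose G k := if unpickle k is Some i then F i else set0.
have WG : W `<=` \bigcup_k G k.
  by move=> x /WF[i _ Fx]; exists (pickle i) => //; rewrite /G pickleK.
apply: (negligibleS WG); apply: negligible_bigcup => k; rewrite /G.
case: unpickle => [i|]; last exact: negligible_set0.
by have [mF F0] := hF i; exists (F i); split.
Qed.

(** * The mesh and the finite element space *)

Section mesh_topology.
Context {R : realType}.

(** The continuous image of the compact set of barycentric coordinates, which are taken as nested
    pairs in the unit cube of dimension four subject to the closed condition that they sum to 1. *)
Lemma tetrahedron_compact (P : 'I_4 -> R3 R) : compact (tetrahedron P).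
Proof.
pose o (i : nat) : 'I_4 := inord i.
pose f (x : R * R * R * R) : R3 R :=
  x.1.1.1 *: P (o 0) + x.1.1.2 *: P (o 1) + x.1.2 *: P (o 2) + x.2 *: P (o 3).
pose s (x : R * R * R * R) : R := x.1.1.1 + x.1.1.2 + x.1.2 + x.2.
pose K : set (R * R * R * R) := (`[0, 1] `*` `[0, 1] `*` `[0, 1] `*` `[0, 1]) `&` s @^-1` [set 1].
have c4 (x : R * R * R * R) : x.2 @[x --> x] --> x.2 by exact: snd_continuous.
have cf1 (x : R * R * R * R) : x.1 @[x --> x] --> x.1 := @fst_continuous R _ _ x.
have c3 (x : R * R * R * R) : x.1.2 @[x --> x] --> x.1.2.
  exact: (cvg_comp _ _ (cf1 x) (@snd_continuous R _ _ x.1)).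
have cf2 (x : R * R * R * R) : x.1.1 @[x --> x] --> x.1.1.
  exact: (cvg_comp _ _ (cf1 x) (@fst_continuous R _ _ x.1)).
have c2 (x : R * R * R * R) : x.1.1.2 @[x --> x] --> x.1.1.2.
  exact: (cvg_comp _ _ (cf2 x) (@snd_continuous R _ _ x.1.1)).
have c1 (x : R * R * R * R) : x.1.1.1 @[x --> x] --> x.1.1.1.
  exact: (cvg_comp _ _ (cf2 x) (@fst_continuous R _ _ x.1.1)).
have cs : continuous s by move=> x; exact: (cvgD (cvgD (cvgD (c1 x) (c2 x)) (c3 x)) (c4 x)).
have cf : continuous f.
  move=> x; apply: cvgD; last by apply: cvgZr_tmp; exact: (c4 x).
  apply: cvgD; last by apply: cvgZr_tmp; exact: (c3 x).
  by apply: cvgD; apply: cvgZr_tmp; [exact: (c1 x)|exact: (c2 x)].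
have cK : compact K.
  apply: compact_closedI.
    by do 3?[apply: compact_setX]; exact: segment_compact.
  by apply: preimage_closed; [move=> x _; exact: cs|exact: closed_eq].
suff -> : tetrahedron P = f @` K.
  by apply: continuous_compact => //; exact: continuous_subspaceT.
have sumE (V : nmodType) (g : 'I_4 -> V) : \sum_i g i = g (o 0) + g (o 1) + g (o 2) + g (o 3).
  rewrite !big_ord_recl big_ord0 addr0 !addrA.
  by congr (g _ + g _ + g _ + g _); apply: val_inj; rewrite /= inordK.
apply/seteqP; split=> x.
  move=> [l [l0 l1 ->]]; exists (l (o 0), l (o 1), l (o 2), l (o 3)); last by rewrite sumE.
  split; last by rewrite /s/= -l1 sumE.
  have le1 i : l i <= 1 by rewrite -l1 (bigD1 i)//= lerDl sumr_ge0.
  by rewrite /= !in_itv/= !l0 !le1.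
move=> [[[[a b] c] d] [[[[/= a01 b01] c01] d01] sE] <-].
rewrite !in_itv/= in a01 b01 c01 d01.
pose l (i : 'I_4) := [:: a; b; c; d]`_i.
have lE : [/\ l (o 0) = a, l (o 1) = b, l (o 2) = c & l (o 3) = d].
  by rewrite /l /o !inordK.
case: lE => la lb lc ld; exists l; split.
- move=> [[|[|[|[|//]]]] i] /=; rewrite /l/=; [by case/andP: a01|by case/andP: b01|by case/andP: c01|by case/andP: d01].
- by rewrite sumE la lb lc ld.
- by rewrite sumE la lb lc ld.
Qed.

Lemma tetrahedron_closed (P : 'I_4 -> R3 R) : closed (tetrahedron P).
Proof. by apply: compact_closed; [exact: norm_hausdorff|exact: tetrahedron_compact]. Qed.

Lemma tetrahedron_convex (P : 'I_4 -> R3 R) x y (t : R) : 0 <= t <= 1 ->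
  tetrahedron P x -> tetrahedron P y -> tetrahedron P ((1 - t) *: x + t *: y).
Proof.
move=> /andP[t0 t1] [l [l0 l1 ->]] [m [m0 m1 ->]].
exists (fun i => (1 - t) * l i + t * m i); split.
- by move=> i; rewrite addr_ge0// mulr_ge0// subr_ge0.
- by rewrite big_split/= -!mulr_sumr l1 m1 !mulr1 subrK.
- rewrite !scaler_sumr -big_split/=; apply: eq_bigr => i _.
  by rewrite [RHS]scalerDl -!scalerA.
Qed.

(** The inscribed ball is Euclidean, neighbourhoods use the max norm; the radius r / 2 works because
    3 * (r / 2)^2 <= r^2. *)
Lemma tetrahedron_nbhs (kappa : R) N (T : 'I_N -> 'I_4 -> R3 R) i :
  shape_regular kappa T -> exists z : R3 R, nbhs z (tetrahedron (T i)).
Proof.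
move=> /(_ i)[z [r [r0 hr _]]]; exists z.
apply/nbhs_ballP; exists (r / 2); first by rewrite /= divr_gt0.
move=> y; rewrite -ball_normE/= => zy; apply: hr.
rewrite /edist -[leRHS](ger0_norm (ltW r0)) -sqrtr_sqr ler_wsqrtr//.
have := dot_le (z - y) (z - y); rewrite ger0_norm ?dot_ge0// => h.
apply: (le_trans h).
have h2 : `|z - y| * `|z - y| <= r / 2 * (r / 2) by rewrite ler_pM// ltW.
apply: (@le_trans _ _ (3 * (r / 2 * (r / 2)))); first by rewrite ler_pM2l.
by have := sqr_ge0 r; rewrite expr2; nra.
Qed.

(** By convexity, contracting towards x with ratio t keeps the tetrahedron inside itself and carries
    the neighbourhood of z to one of x + t (z - x), which lies in Q for small t. *)
Lemma tetrahedron_interior_dense (P : 'I_4 -> R3 R) (z x : R3 R) (Q : set (R3 R)) :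
  nbhs z (tetrahedron P) -> tetrahedron P x -> nbhs x Q ->
  exists O, [/\ open O, O !=set0, O `<=` tetrahedron P & O `<=` Q].
Proof.
move=> nz Px nQ; exists (interior (tetrahedron P `&` Q)).
split; [exact: open_interior| |by move=> y /interior_subset[]|by move=> y /interior_subset[]].
have cx : x + t *: (z - x) @[t --> (0 : R)] --> x.
  rewrite -[X in _ --> X]addr0 -(scale0r (z - x)).
  by apply: cvgD; [exact: cvg_cst|apply: cvgZr_tmp; exact: cvg_id].
have nQ' : nbhs x (interior Q) by exact: nbhs_interior.
have : \forall t \near (0 : R), interior Q (x + t *: (z - x)) by exact: (cx _ nQ').
move=> /nbhs_ballP[e /= e0 he].
pose t := Num.min 1 (e / 2).
have t0 : 0 < t by rewrite lt_min ltr01 divr_gt0.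
have t1 : t <= 1 by rewrite ge_min lexx.
have te : ball 0 e t.
  rewrite -ball_normE/= sub0r normrN gtr0_norm// (@le_lt_trans _ _ (e / 2))//.
    by rewrite ge_min lexx orbT.
  by rewrite ltr_pdivrMr// mulr_natr mulr2n ltrDl.
exists (x + t *: (z - x)); apply: filterI; last exact: he.
(* The inverse of the contraction: y is the convex combination of x and [h y] with weight t. *)
pose h (y : R3 R) := x + t^-1 *: (y - x).
have ch : h y @[y --> x + t *: (z - x)] --> h (x + t *: (z - x)).
  apply: cvgD; first exact: cvg_cst.
  by apply: cvgZl_tmp; apply: cvgB; [exact: cvg_id|exact: cvg_cst].
have hE : h (x + t *: (z - x)) = z.
  by rewrite /h addrAC subrr add0r scalerA mulVf ?gt_eqF// scale1r addrC subrK.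
rewrite hE in ch.
have nh : \forall y \near x + t *: (z - x), tetrahedron P (h y) by exact: (ch _ nz).
apply: filterS nh => y hy; change (tetrahedron P y).
have -> : y = (1 - t) *: x + t *: h y.
  rewrite /h scalerDr scalerA divff ?gt_eqF// scale1r scalerBl scale1r.
  by rewrite addrA subrK addrC subrK.
by apply: tetrahedron_convex => //; rewrite ltW.
Qed.

Variables (N : nat) (T : 'I_N -> 'I_4 -> R3 R) (S : {set 'I_N}).

Lemma omega_h_closed : closed (omega_h T S).
Proof.
apply: closed_bigcup => [|i _]; last exact: tetrahedron_closed.
exact: finite_finset.
Qed.

Variables (Omega Gamma : set (R3 R)) (sigma : {measure set (R3 R) -> \bar R}).
Hypothesis cG : compact Gamma.
Hypothesis sG : smooth_surface Gamma.
Hypothesis hsigma : surface_measure Gamma sigma.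
Hypothesis GO : Gamma `<=` Omega.
Hypothesis hT : tetrahedral_partition Omega T.
Hypothesis hS : cut_mesh Gamma sigma T S.

(** The elements cover Omega, so a point of Gamma outside omega_h lies in some element. The cut of
    that element is null, for otherwise the element would be kept or its cut would lie in a kept
    neighbour. Hence the part of Gamma outside omega_h is covered by finitely many null cuts. *)
Lemma Gamma_sub_omega_h : Gamma `<=` omega_h T S.
Proof.
move=> x Gx; apply: contrapT => nx.
have mG := Gamma_measurable cG.
have oO : open (~` omega_h T S) by exact/closed_openC/omega_h_closed.
have := sigma_open_gt0 cG sG hsigma oO nx Gx; rewrite lt0e => /andP[/eqP + _]; apply.
have mT i : measurable (Defs.cut Gamma T i).
  by apply: measurableI => //; apply: closed_measurable3; exact: tetrahedron_closed.
pose J := [set i | sigma (Defs.cut Gamma T i) = 0%E].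
have mJ : measurable (\bigcup_(i in J) Defs.cut Gamma T i).
  by apply: fin_bigcup_measurable => //; exact: finite_finset.
have J0 : sigma (\bigcup_(i in J) Defs.cut Gamma T i) = 0%E.
  apply: (@bigcup_null _ _ _ sigma _ (fun i => if i \in J then Defs.cut Gamma T i else set0)) => //.
  - by move=> i; case: ifP => [/set_mem//|_]; split.
  - by move=> y [i Ji yi]; exists i; rewrite // mem_set.
apply: (subset_measure0 _ mJ _ J0).
  by apply: measurableI => //; exact: open_measurable3.
move=> y [Gy ny]; have [_ covT _] := hT; have [_ hcov _] := hS.
have : closure Omega y by apply: subset_closure; exact: GO.
rewrite -covT => -[i _ Ti]; exists i; last by split.
apply: contrapT => si; apply: ny.
have [iS|niS] := boolP (i \in S); first by exists i.
by have [j [jS _ /(_ y (conj Ti Gy))[_ Tj]]] := hcov i si niS; exists j.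
Qed.

End mesh_topology.

Section finite_elements.
Context {R : realType}.
Variables (k N : nat) (T : 'I_N -> 'I_4 -> R3 R) (S : {set 'I_N}).
Local Notation W := (W_h k T S).
Local Notation omega := (omega_h T S).

Lemma polynomial_onD A (u v : R3 R -> R) c :
  polynomial_on k A u -> polynomial_on k A v -> polynomial_on k A (u + c *: v).
Proof.
move=> [p pk pu] [q qk qv]; exists (p + c *: q).
  apply: (leq_trans (mpoly.msizeD_le _ _)); rewrite geq_max pk/=.
  exact: (leq_trans (mpoly.msizeZ_le _ _)).
by move=> x Ax; rewrite mpoly.mevalD mpoly.mevalZ -pu// -qv.
Qed.

Lemma W_hD (u v : R3 R -> R) (c : R) : W u -> W v -> W (u + c *: v).
Proof.
move=> [cu pu u0] [cv pv v0]; split.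
- move=> x; apply: cvgD; first exact: cu.
  by apply: cvgZl_tmp; exact: cv.
- by move=> i iS; apply: polynomial_onD; [exact: pu|exact: pv].
- by move=> x nx; rewrite !fctE u0// v0// scaler0 addr0.
Qed.

Lemma W_h0 : W 0.
Proof.
split=> //; first by move=> x; exact: cvg_cst.
by move=> i _; exists 0; [rewrite mpoly.msize0|move=> x _; rewrite mpoly.meval0].
Qed.

Lemma W_hZ (v : R3 R -> R) (c : R) : W v -> W (c *: v).
Proof. by move=> Wv; rewrite -[c *: v]add0r; apply: W_hD => //; exact: W_h0. Qed.

(** The pieces are taken as functions on the whole space, so that they are differentiable across the
    faces and can be composed with charts. *)
Lemma W_h_pieces v : W v -> exists P : 'I_N -> R3 R -> R,
  (forall i, C1 setT (P i)) /\ forall i x, i \in S -> tetrahedron (T i) x -> v x = P i x.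
Proof.
move=> [_ pv _].
have /choice[P hP] : forall i, exists P : R3 R -> R, C1 setT P /\
    (i \in S -> forall x, tetrahedron (T i) x -> v x = P x).
  move=> i; have [iS|niS] := boolP (i \in S); last first.
    by exists (cst 0); split=> //; exact: C1_cst.
  have [p _ hp] := pv i iS; exists (fun x => mpoly.meval (Defs.coord x) p).
  by split; [exact: C1_meval|move=> _ x; exact: hp].
exists P; split=> [i|i x iS Tx]; first by have [] := hP i.
by have [_ h] := hP i; exact: h.
Qed.

Lemma C1_continuous (p : R3 R -> R) : C1 setT p -> continuous p.
Proof. by move=> hp x; have [dp _] := hp x I; exact: differentiable_continuous. Qed.

Lemma compact_fun_bounded (A : set (R3 R)) (f : R3 R -> R) :
  compact A -> {within A, continuous f} -> exists M : R, forall x, A x -> `|f x| <= M.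
Proof.
move=> cA cf; have /compact_bounded[M [_ hM]] := continuous_compact cf cA.
by exists (M + 1) => x Ax; apply: (hM (M + 1)); [rewrite ltrDl|exists x].
Qed.

Lemma W_h_bounded v : W v -> exists2 M : R, 0 <= M & forall x, `|v x| <= M.
Proof.
move=> Wv; have [_ _ v0] := Wv; have [P [C1P vP]] := W_h_pieces Wv.
have /choice[M hM] : forall i, exists M : R, forall x, tetrahedron (T i) x -> `|P i x| <= M.
  move=> i; apply: compact_fun_bounded; first exact: tetrahedron_compact.
  by apply: continuous_subspaceT; exact: C1_continuous.
exists (\sum_i `|M i|) => [|x]; first exact: sumr_ge0.
have [[i iS Tx]|nx] := pselect (omega x); last by rewrite v0// normr0 sumr_ge0.
rewrite (vP i x iS Tx) (bigD1 i)//= ler_wpDr// ?sumr_ge0//.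
by apply: (le_trans (hM i x Tx)); exact: ler_norm.
Qed.

Lemma W_h_restrict v : W v -> v \_ omega = v.
Proof.
move=> [_ _ v0]; apply: funext => x; rewrite patchE; case: ifPn => // /negP nx.
by rewrite v0// => ox; apply: nx; rewrite mem_set.
Qed.

Lemma W_h_measurable v : W v -> measurable_fun setT v.
Proof.
move=> Wv; rewrite -(W_h_restrict Wv).
have mo : measurable omega by apply: closed_measurable3; exact: omega_h_closed.
by apply: (iffLR (measurable_restrictT _ mo)); apply: within_measurable3 => //; case: Wv.
Qed.

(** The point with nonzero value may lie on the boundary of omega_h; the polynomial piece stays
    nonzero near it, and the tetrahedron has interior points arbitrarily close. *)
Lemma W_h_neq0_open kappa v : shape_regular kappa T -> W v -> v <> 0 ->
  exists O, [/\ open O, O !=set0 & forall x, O x -> v x != 0].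
Proof.
move=> sr Wv v0; have [x vx] : exists x, v x != 0.
  apply: contrapT => h; apply: v0; apply: funext => x; apply/eqP/negPn/negP => vx.
  by apply: h; exists x.
have [_ _ vout] := Wv; have [P [C1P vP]] := W_h_pieces Wv.
have [i iS Tx] : omega x.
  by apply: contrapT => nx; move: vx; rewrite vout// eqxx.
have cP := C1_continuous (C1P i).
have oQ : open (P i @^-1` [set y | y != 0]).
  by apply: open_comp; [move=> y _; exact: cP|exact: open_neq].
have [z nz] := tetrahedron_nbhs i sr.
have [|O [oO O0 OT OQ]] := tetrahedron_interior_dense nz Tx (Q := P i @^-1` [set y | y != 0]).
  by apply: open_nbhs_nbhs; split=> //=; rewrite -vP.
by exists O; split=> // y Oy; rewrite (vP i y)//; [exact: OQ|exact: OT].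
Qed.

(* The elements overlap along their faces: a point is assigned to the first
   element that contains it. *)
Definition first_cell (i : 'I_N) : set (R3 R) :=
  [set x | [/\ i \in S, tetrahedron (T i) x &
     forall j : 'I_N, (j < i)%N -> j \in S -> ~ tetrahedron (T j) x]].

Lemma first_cell_ex x : omega x -> exists i, first_cell i x.
Proof.
move=> [i iS Tx].
have exn : exists n, `[< exists j : 'I_N, [/\ j \in S, tetrahedron (T j) x & j = n :> nat] >].
  by exists i; apply/asboolP; exists i.
case: (ex_minnP exn) => n /asboolP[j [jS Tj jn]] hmin; exists j; split=> // l lj lS Tl.
by have := hmin l; rewrite -jn leqNgt lj => /(_ (asboolT (ex_intro _ l (And3 lS Tl erefl)))).
Qed.

Lemma first_cell_unique x i j : first_cell i x -> first_cell j x -> i = j.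
Proof.
move=> [iS Ti hi] [jS Tj hj]; apply: val_inj; apply/eqP; rewrite eqn_leq.
by apply/andP; split; rewrite leqNgt; apply/negP => h; [exact: (hi _ h jS Tj)|exact: (hj _ h iS Ti)].
Qed.

(** In general discontinuous across faces, hence outside W_h: a finite family whose span contains
    W_h. The bound k.+1 on the degree is strict, so degrees are at most k. *)
Definition local_monomial (im : 'I_N * mpoly.bmultinom 3 k.+1) : R3 R -> R :=
  fun x => \1_(first_cell im.1) x *
    mpoly.meval (Defs.coord x) (mpoly.mpolyX R (mpoly.bmnm im.2)).

Lemma W_h_span v : W v -> exists c : 'I_N * mpoly.bmultinom 3 k.+1 -> R,
  v = \sum_im c im *: local_monomial im.
Proof.
move=> [_ pv v0].
have /choice[p hp] : forall i, exists p : mpoly.mpoly 3 R, (mpoly.msize p <= k.+1)%N /\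
    (i \in S -> forall x, tetrahedron (T i) x -> v x = mpoly.meval (Defs.coord x) p).
  move=> i; have [iS|niS] := boolP (i \in S); last by exists 0; rewrite mpoly.msize0.
  by have [p pk hp] := pv i iS; exists p.
exists (fun im => mpoly.mcoeff (mpoly.bmnm im.2) (p im.1)); apply: funext => x.
rewrite fct_sumE.
have E i : \sum_(m : mpoly.bmultinom 3 k.+1) (mpoly.mcoeff (mpoly.bmnm m) (p i) *:
    local_monomial (i, m)) x = \1_(first_cell i) x * mpoly.meval (Defs.coord x) (p i).
  have [pk _] := hp i; rewrite [in RHS](mpoly.mpolywE pk) (big_morph _ (mpoly.mevalD _) (mpoly.meval0 _)) mulr_sumr.
  by apply: eq_bigr => m _; rewrite mpoly.mevalZ /local_monomial /= mulrCA.
rewrite -(pair_bigA _ (fun i m => (mpoly.mcoeff (mpoly.bmnm m) (p i) *: local_monomial (i, m)) x))/=.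
under eq_bigr do rewrite E.
have [ox|nx] := pselect (omega x).
  have [i fi] := first_cell_ex ox; rewrite (bigD1 i)//= big1 => [|j ji].
    rewrite addr0 indicE mem_set// mul1r; case: fi => iS Ti _.
    by have [_ h] := hp i; exact: h.
  rewrite indicE memNset ?mul0r// => fj; move/eqP: ji; apply; exact: first_cell_unique fj fi.
rewrite v0// big1// => i _; rewrite indicE memNset ?mul0r// => -[iS Ti _].
by apply: nx; exists i.
Qed.

End finite_elements.

(** * Integrals and bilinear forms *)

Section integrals.
Context d (T : measurableType d) (R : realType) (mu : {measure set T -> \bar R}).
Import HBNNSimple.

(* [f] is arbitrary because the surface gradient of a function of W_h is only
   shown to be measurable off a null set. *)
Lemma ge0_integral_setD_null (D Z : set T) (f : T -> \bar R) :
  (forall x, D x -> 0 <= f x)%E -> measurable Z -> mu Z = 0%E ->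
  (\int[mu]_(x in D) f x = \int[mu]_(x in D `\` Z) f x)%E.
Proof.
move=> f0 mZ Z0; rewrite !ge0_integralE//; last by move=> x [/f0].
have f0' x : (0 <= (f \_ D) x)%E by apply: erestrict_ge0.
apply/eqP; rewrite eq_le; apply/andP; split; last first.
  apply: le_ereal_sup => _ [h hf <-]; exists h => // x; apply: (le_trans (hf x)).
  rewrite !patchE; case: ifPn => [|_]; last exact: f0'.
  by rewrite inE => -[Dx _]; rewrite mem_set.
apply: ge_ereal_sup => _ [h hf <-].
have mZC := measurableC mZ.
(* Cutting a simple function off on the null set Z preserves its integral and puts it below f
   restricted to D minus Z. *)
pose h' : {nnsfun T >-> R} := proj_nnsfun h mZC.
have -> : sintegral mu h = sintegral mu h'.
  rewrite -!integralT_nnsfun (ge0_negligible_integral mZ measurableT _ _ Z0)//; last first.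
  - by move=> x _; rewrite lee_fin.
  - exact/measurable_EFinP.
  rewrite [RHS](ge0_negligible_integral mZ measurableT _ _ Z0)//; last first.
  - by move=> x _; rewrite lee_fin.
  - exact/measurable_EFinP.
  apply: eq_integral => x; rewrite inE => -[_ nZx].
  by rewrite /h' /proj_nnsfun /= mindicE mem_set// mulr1.
apply: ereal_sup_ubound; exists h' => // x; rewrite /h' /proj_nnsfun /= mindicE.
have [xZ|nxZ] := boolP (x \in ~` Z); last first.
  by rewrite mulr0; apply: erestrict_ge0 => y [/f0].
rewrite mulr1; apply: (le_trans (hf x)); rewrite !patchE.
case: ifPn => xD; case: ifPn => // h1.
  by case/negP: h1; apply/mem_set; split; exact/set_mem.
by move: h1; rewrite inE => -[/mem_set]; rewrite (negbTE xD).
Qed.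

Lemma Rintegral_setD_null (D Z : set T) (f : T -> R) : measurable Z -> mu Z = 0%E ->
  \int[mu]_(x in D) f x = \int[mu]_(x in D `\` Z) f x.
Proof.
move=> mZ Z0; rewrite /Rintegral integralE [in RHS]integralE.
by congr (fine (_ - _)); apply: ge0_integral_setD_null.
Qed.

Lemma bounded_integrable (A : set T) (f : T -> R) (M : R) : measurable A -> (mu A < +oo)%E ->
  measurable_fun A f -> (forall x, A x -> `|f x| <= M) -> mu.-integrable A (EFin \o f).
Proof.
move=> mA Afin mf fM; apply: measurable_bounded_integrable => //.
exists M; split; first exact: num_real.
by move=> y My x Ax; apply: (le_trans (fM x Ax)); exact: ltW.
Qed.

(** Boundedness and a support of finite measure make the norm finite, and the nonnegligible support
    makes it nonzero. It is applied to both normalizations in (ii), with Lebesgue measure on omega_h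
    and with the surface measure. *)
Lemma Lnorm2_normalize (A : set T) (u : T -> R) (M : R) : measurable A -> (mu A < +oo)%E ->
  measurable_fun setT u -> (forall x, `|u x| <= M) -> (forall x, ~ A x -> u x = 0) ->
  ~ mu.-negligible [set x | u x != 0] ->
  exists2 c : R, 0 < c & ('N[mu]_(2%:E)[EFin \o (c *: u)] = 1)%E.
Proof.
move=> mA Afin mu_ uM u0 nn.
have uL : u \in Lfun mu 2%:E.
  rewrite inE; apply/andP; split; rewrite inE //= /finite_norm.
  have : (\int[mu]_x (`|u x| `^ 2)%:E <= (M ^+ 2)%:E * mu A)%E.
    rewrite -[leRHS]integral_cst// [leRHS]integral_mkcond.
    apply: ge0_le_integral => //.
    - apply/measurable_EFinP; apply: (measurableT_comp (measurable_powR _)) => //.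
      exact: measurableT_comp.
    - by apply/(measurable_restrictT _ mA); exact: measurable_cst.
    - move=> x _; rewrite patchE; case: ifPn => [xA|/negP nA].
        by rewrite lee_fin powR_mulrn// ler_pXn2r ?nnegrE// (le_trans _ (uM x)).
      by rewrite u0 ?normr0 ?powR0// => Ax; apply: nA; rewrite mem_set.
  move=> /le_lt_trans h; apply: (@lty_poweRy _ _ 2) => //; rewrite poweR_Lnorm//; apply: h.
  by apply: lte_mul_pinfty; rewrite ?lee_fin ?sqr_ge0.
have Nfin : ('N[mu]_(2%:E)[EFin \o u] < +oo)%E.
  by move: uL; rewrite inE => /andP[_]; rewrite inE.
have Npos := Lnorm_ge0 mu 2%:E (EFin \o u).
have N0 : 'N[mu]_(2%:E)[EFin \o u]%E != 0%E.
  apply/eqP => /Lnorm_eq0_eq0 h; apply: nn.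
  have [|//|B [mB B0 hB]] := h; first exact/measurable_EFinP.
  exists B; split=> // x ux; apply: hB => /= /(_ I)/eqP.
  by rewrite eqe (negbTE ux).
pose n := fine 'N[mu]_(2%:E)[EFin \o u]%E.
have nE : 'N[mu]_(2%:E)[EFin \o u]%E = n%:E by rewrite fineK// ge0_fin_numE.
have n0 : 0 < n by rewrite -lte_fin -nE lt0e N0.
exists n^-1; first by rewrite invr_gt0.
have p1 : (1 <= 2%:E :> \bar R)%E by rewrite lee_fin ler1n.
have := LnormZ (Lfun_Sub p1 uL : LfunType mu p1) n^-1.
rewrite Lfun_valP => E; transitivity ('N[mu]_2%:E[EFin \o n^-1 \*: u])%E => //.
by rewrite E nE -EFinM gtr0_norm ?invr_gt0// mulVf ?gt_eqF.
Qed.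

End integrals.

Section forms.
Context {R : realType}.
Variables (Gamma : set (R3 R)) (sigma : {measure set (R3 R) -> \bar R}).
Hypothesis cG : compact Gamma.
Hypothesis sG : smooth_surface Gamma.
Hypothesis hsigma : surface_measure Gamma sigma.

(** Existence of the gradient off Z yields additivity; measurability, by coordinates, and
    boundedness yield integrability of the products of two gradients. *)
Definition regular_off (Z : set (R3 R)) (u : R3 R -> R) :=
  [/\ forall x, Gamma x -> ~ Z x -> is_surface_grad Gamma u x (surface_grad Gamma u x),
      forall c, measurable_fun (Gamma `\` Z) (fun x => coordL c (surface_grad Gamma u x)) &
      exists M : R, forall x, (Gamma `\` Z) x -> `|surface_grad Gamma u x| <= M].

Lemma regular_off_sub Z Z' u : measurable Z -> measurable Z' -> Z `<=` Z' ->
  regular_off Z u -> regular_off Z' u.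
Proof.
move=> mZ mZ' ZZ' [h1 h2 [M hM]].
have sub : Gamma `\` Z' `<=` Gamma `\` Z by move=> x [Gx nZ]; split=> // /ZZ'.
split.
- by move=> x Gx nZ; apply: h1 => // /ZZ'.
- move=> c; apply: (measurable_funS _ sub (h2 c)).
  by apply: measurableD => //; exact: (Gamma_measurable cG).
- by exists M => x /sub/hM.
Qed.

Lemma regular_off_integrable Z u v : measurable Z -> regular_off Z u -> regular_off Z v ->
  sigma.-integrable (Gamma `\` Z)
   (EFin \o (fun x => dot (surface_grad Gamma u x) (surface_grad Gamma v x))).
Proof.
move=> mZ [_ mu [M hM]] [_ mv [L hL]].
have mG : measurable Gamma := Gamma_measurable cG.
have mGZ : measurable (Gamma `\` Z) by exact: measurableD.
apply: (@bounded_integrable _ _ _ _ _ _ (3 * (M * L))) => //.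
- apply: (le_lt_trans _ (sigma_Gamma_fin cG sG hsigma)).
  by apply: le_measure; rewrite ?inE// => x [].
- by apply: measurable_sum => c; apply: measurable_funM; [exact: mu|exact: mv].
- move=> x Gx; apply: (le_trans (dot_le _ _)); rewrite ler_pM2l//.
  by apply: ler_pM => //; [exact: hM|exact: hL].
Qed.

Lemma bilin_aE Z u v : measurable Z -> sigma Z = 0%E ->
  bilin_a Gamma sigma u v =
  \int[sigma]_(x in Gamma `\` Z) dot (surface_grad Gamma u x) (surface_grad Gamma v x).
Proof. exact: Rintegral_setD_null. Qed.

Lemma bilin_aC u v : bilin_a Gamma sigma u v = bilin_a Gamma sigma v u.
Proof. by apply: eq_Rintegral => x _; rewrite dotC. Qed.

Lemma bilin_a_ge0 u : 0 <= bilin_a Gamma sigma u u.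
Proof. by apply: Rintegral_ge0 => x _; exact: dot_ge0. Qed.

Definition regular u := exists Z, [/\ measurable Z, sigma Z = 0%E & regular_off Z u].

Lemma regular2 u v : regular u -> regular v -> exists Z,
  [/\ measurable Z, sigma Z = 0%E, regular_off Z u & regular_off Z v].
Proof.
move=> [Z1 [m1 z1 r1]] [Z2 [m2 z2 r2]]; have mU := measurableU _ _ m1 m2.
exists (Z1 `|` Z2); split=> //.
- exact: (subset_setU_measure0 m1 m2 mU z1 z2).
- exact: (regular_off_sub m1 mU (@subsetUl _ Z1 Z2)).
- exact: (regular_off_sub m2 mU (@subsetUr _ Z1 Z2)).
Qed.

Lemma bilin_aDl u v w c : regular u -> regular v -> regular w ->
  bilin_a Gamma sigma (u + c *: v) w = bilin_a Gamma sigma u w + c * bilin_a Gamma sigma v w.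
Proof.
move=> ru rv [Z2 [m2 z2 r2]]; have [Z1 [m1 z1 ru1 rv1]] := regular2 ru rv.
have mU := measurableU _ _ m1 m2.
have zU : sigma (Z1 `|` Z2) = 0%E by exact: (subset_setU_measure0 m1 m2 mU z1 z2).
move: ru1 rv1 r2 => /(regular_off_sub m1 mU (@subsetUl _ Z1 Z2)) ru'.
move=> /(regular_off_sub m1 mU (@subsetUl _ Z1 Z2)) rv'.
move=> /(regular_off_sub m2 mU (@subsetUr _ Z1 Z2)) rw'.
rewrite !(bilin_aE _ _ mU zU).
have mG : measurable Gamma := Gamma_measurable cG.
have mGZ : measurable (Gamma `\` (Z1 `|` Z2)) by exact: measurableD.
have iu := regular_off_integrable mU ru' rw'; have iv := regular_off_integrable mU rv' rw'.
rewrite -(RintegralZl c mGZ iv) -(RintegralD mGZ iu (integrableZl mGZ c iv)).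
apply: eq_Rintegral => x; rewrite inE => -[Gx nZ].
have [hu _ _] := ru'; have [hv _ _] := rv'.
rewrite (surface_gradE (is_surface_gradD c (hu _ Gx nZ) (hv _ Gx nZ))).
by rewrite dotDl dotZl.
Qed.

Lemma bilin_l2C u v : bilin_l2 Gamma sigma u v = bilin_l2 Gamma sigma v u.
Proof. by apply: eq_Rintegral => x _; rewrite mulrC. Qed.

Definition bounded_measurable (v : R3 R -> R) :=
  measurable_fun setT v /\ exists M : R, forall x, `|v x| <= M.

Lemma bounded_measurable_integrable v : bounded_measurable v ->
  sigma.-integrable Gamma (EFin \o v).
Proof.
move=> [mv [M hM]]; apply: (@bounded_integrable _ _ _ _ _ _ M) => //.
- exact: (Gamma_measurable cG).
- exact: sigma_Gamma_fin.
- exact: measurable_funTS.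
Qed.

Lemma bounded_measurable_mul f v : sigma.-integrable Gamma (EFin \o f) ->
  bounded_measurable v -> sigma.-integrable Gamma (EFin \o (fun x => f x * v x)).
Proof.
move=> fi [mv [M hM]].
have mG : measurable Gamma := Gamma_measurable cG.
apply: (integrableMl mG fi); first exact: measurable_funTS.
exists M; split; first exact: num_real.
by move=> y My x Ax; apply: (le_trans (hM x)); exact: ltW.
Qed.

(** The first argument is merely integrable, so that the right-hand side f, integrable because it is
    square integrable and sigma is finite, is covered along with functions of W_h. *)
Lemma bilin_l2Dr f u v c : sigma.-integrable Gamma (EFin \o f) ->
  bounded_measurable u -> bounded_measurable v ->
  bilin_l2 Gamma sigma f (u + c *: v) = bilin_l2 Gamma sigma f u + c * bilin_l2 Gamma sigma f v.
Proof.
move=> fi bu bv; have mG : measurable Gamma := Gamma_measurable cG.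
have iu := bounded_measurable_mul fi bu; have iv := bounded_measurable_mul fi bv.
rewrite /bilin_l2 -(RintegralZl c mG iv) -(RintegralD mG iu (integrableZl mG c iv)).
by apply: eq_Rintegral => x _; rewrite !fctE /GRing.scale/=; ring.
Qed.

Lemma Lfun2_integrable_Gamma f : f \in Lfun sigma 2%:E -> sigma.-integrable Gamma (EFin \o f).
Proof.
move=> fL; apply: (@integrableS _ _ _ _ setT) => //; first exact: (Gamma_measurable cG).
apply/Lfun1_integrable; apply: Lfun_subset12 => //.
by rewrite ge0_fin_numE//; exact: (sigmaT_fin cG sG hsigma).
Qed.

Lemma bilin_l2_ge0 u : 0 <= bilin_l2 Gamma sigma u u.
Proof. by apply: Rintegral_ge0 => x _; rewrite -expr2 sqr_ge0. Qed.

(** The square of u has zero integral, so u vanishes off a null set; the points of Gamma with u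
    nonzero form a relatively open set, which would have positive measure if it were not empty. *)
Lemma bilin_l2_eq0 u : bounded_measurable u -> {within Gamma, continuous u} ->
  bilin_l2 Gamma sigma u u = 0 -> forall x, Gamma x -> u x = 0.
Proof.
move=> bu cu; have mG : measurable Gamma := Gamma_measurable cG.
have iu := bounded_measurable_mul (bounded_measurable_integrable bu) bu.
rewrite /bilin_l2 /Rintegral => i0 x Gx.
have i1 : (\int[sigma]_(x in Gamma) `|(u x * u x)%:E|)%E = 0%E.
  transitivity (\int[sigma]_(x in Gamma) (u x * u x)%:E)%E.
    by apply: eq_integral => y _; rewrite gee0_abs// lee_fin -expr2 sqr_ge0.
  by rewrite -[LHS]fineK ?i0//; exact: (integrable_fin_num _ iu).
have mu2 : measurable_fun Gamma (EFin \o (fun x => u x * u x)) by exact: (measurable_int _ iu).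
have [B [mB B0 hB]] := iffLR (@ae_eq_integral_abs _ _ _ sigma Gamma mG _ mu2) i1.
apply/eqP/negPn/negP => ux.
have [V oV VE] := within_preimage_open cu (@open_neq R 0).
have Vx : (Gamma `&` V) x by rewrite -VE.
have := sigma_open_gt0 cG sG hsigma oV (proj2 Vx) Gx.
rewrite lt0e => /andP[/eqP + _]; apply.
apply: (subset_measure0 _ mB _ B0).
  by apply: measurableI => //; exact: open_measurable3.
move=> y GVy; apply: hB => /=; have Gy : Gamma y by case: GVy.
move=> /(_ Gy) [] /eqP; rewrite mulf_eq0 orbb => /eqP uy.
by move: GVy; rewrite -VE => -[_]; rewrite /= uy eqxx.
Qed.

End forms.

Lemma measurable_fun_fin_cover d (T : measurableType d) (R : realType) (I : finType)
    (D : set T) (F : I -> set T) (f : T -> R) (g : I -> T -> R) :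
  (forall i, measurable (F i)) -> (forall x, D x -> exists i, F i x) ->
  (forall i x, D x -> F i x -> f x = g i x) -> (forall i, measurable_fun D (g i)) ->
  measurable_fun D f.
Proof.
move=> mF cF fg mg mD Y mY.
have -> : D `&` f @^-1` Y = \bigcup_i (F i `&` (D `&` g i @^-1` Y)).
  apply/seteqP; split=> x.
    move=> [Dx Yfx]; have [i Fx] := cF _ Dx.
    by exists i => //; split=> //; split=> //=; rewrite -fg.
  by move=> [i _ [Fx [Dx Ygx]]]; split=> //=; rewrite (fg i).
apply: fin_bigcup_measurable => [|i _]; first exact: finite_finset.
by apply: measurableI => //; exact: mg.
Qed.

(** * Linear algebra *)

Section linear_algebra.
Context {R : realType} {E : lmodType R}.

Definition linear_subset (W : set E) :=
  W 0 /\ forall u v (c : R), W u -> W v -> W (u + c *: v).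

(** A span by recursion on the generators, which need not be independent: each step exposes a
    coefficient of the head vector, which is what the inductions below split off. *)
Fixpoint lspan (s : seq E) : set E :=
  if s is e :: s' then [set x | exists c : R, exists2 y, lspan s' y & x = y + c *: e]
  else [set 0].

Lemma lspan_linear s : linear_subset (lspan s).
Proof.
elim: s => [|e s [s0 sD]]; first by split=> // u v c /= -> ->; rewrite scaler0 addr0.
split; first by exists 0, 0 => //; rewrite scale0r addr0.
move=> _ _ c [a [x sx ->]] [b [y sy ->]]; exists (a + c * b), (x + c *: y).
  exact: sD.
by rewrite scalerDr addrACA scalerDl scalerA.
Qed.

Lemma lspan_sum I (r : seq I) (c : I -> R) (b : I -> E) :
  lspan [seq b i | i <- r] (\sum_(i <- r) c i *: b i).
Proof.
elim: r => [|i r IH]; first by rewrite big_nil.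
by rewrite big_cons; exists (c i), (\sum_(j <- r) c j *: b j) => //; rewrite addrC.
Qed.

(** Elimination of one generator: the part of W in the span of b is finitely generated by induction,
    and one element of W with a nonzero coefficient on e, if there is any, supplies the missing
    generator. *)
Lemma linear_subset_lspan b (W : set E) : linear_subset W -> W `<=` lspan b ->
  exists s, W = lspan s.
Proof.
elim: b W => [|e b IH] W [W0 WD] Wb.
  by exists [::]; apply/seteqP; split=> // x ->.
have [l0 lD] := lspan_linear b.
have [|x [] //|s sE] := IH (W `&` lspan b).
  by split=> // u v c [Wu bu] [Wv bv]; split; [exact: WD|exact: lD].
have sW x : lspan s x -> W x /\ lspan b x by rewrite -sE.
have Ws x : W x -> lspan b x -> lspan s x by rewrite -sE.
have [[c [w [y [Ww by_ wE c0]]]]|h] := pselect (exists c w y,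
    [/\ W w, lspan b y, w = y + c *: e & c != 0]).
  exists (w :: s); apply/seteqP; split=> x.
    move=> Wx; have [c1 [y1 by1 xE]] := Wb _ Wx.
    (* This multiple of w cancels the e-component of x, so the remainder lies in the span of b. *)
    exists (c1 / c), (x - (c1 / c) *: w); last by rewrite subrK.
    apply: Ws; rewrite -scaleNr; first exact: WD.
    rewrite xE wE scalerDr addrACA scalerA mulNr divfK// -scalerDl subrr scale0r addr0.
    exact: lD.
  by move=> [a [z /sW[Wz _] ->]]; exact: WD.
exists s; apply/seteqP; split=> x; last by case/sW.
move=> Wx; have [c [y by_ xE]] := Wb _ Wx; apply: Ws => //.
have [c0|c0] := eqVneq c 0; first by rewrite xE c0 scale0r addr0.
by exfalso; apply: h; exists c, x, y.
Qed.

(* Gram-Schmidt, one spanning vector at a time. *)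
Lemma riesz_lspan (B : E -> E -> R) s :
  (forall u v w c, lspan s u -> lspan s v -> lspan s w -> B (u + c *: v) w = B u w + c * B v w) ->
  (forall u v, B u v = B v u) ->
  (forall u, lspan s u -> B u u = 0 -> u = 0) ->
  forall F : E -> R, (forall u v c, lspan s u -> lspan s v -> F (u + c *: v) = F u + c * F v) ->
  exists2 u, lspan s u & forall v, lspan s v -> B u v = F v.
Proof.
elim: s => [|e s IH] Bl BC B0 F Fl.
  exists 0 => // v ->.
  (* Additivity at the zero vector gives F 0 = F 0 + F 0, and likewise for [B], so both values
     vanish. *)
  have := Bl 0 0 0 1 erefl erefl erefl; have := Fl 0 0 1 erefl erefl.
  rewrite scaler0 addr0 !mul1r => /eqP; rewrite -subr_eq0 opprD addNKr oppr_eq0 => /eqP ->.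
  by move=> /eqP; rewrite -subr_eq0 opprD addNKr oppr_eq0 => /eqP.
have [l0 lD] := lspan_linear s; have [l0' lD'] := lspan_linear (e :: s).
have sub x : lspan s x -> lspan (e :: s) x by move=> sx; exists 0, x; rewrite // scale0r addr0.
have le : lspan (e :: s) e by exists 1, 0; rewrite // scale1r add0r.
have {}IH : forall F : E -> R,
    (forall u v c, lspan s u -> lspan s v -> F (u + c *: v) = F u + c * F v) ->
    exists2 u, lspan s u & forall v, lspan s v -> B u v = F v.
  apply: IH => //.
  - by move=> u v w c su sv sw; apply: Bl; exact: sub.
  - by move=> u su; apply: B0; exact: sub.
have [u1 su1 u1E] := IH F (fun u v c su sv => Fl u v c (sub _ su) (sub _ sv)).
(* Representing [B e] on the span of s gives the B-orthogonal projection p of e; the residual r = e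
   - p is B-orthogonal to this span. *)
have [|p sp pE] := IH (B e).
  by move=> u v c su sv; rewrite !(BC e); apply: Bl => //; exact: sub.
have lr : lspan (e :: s) (e + (-1) *: p) by apply: lD' => //; exact: sub.
set r := e + (-1) *: p in lr.
have rE v : lspan s v -> B r v = 0.
  by move=> sv; rewrite /r Bl ?pE// ?mulN1r ?subrr//; exact: sub.
have eE : e = p + r by rewrite /r scaleN1r addrC subrK.
have [r0|r0] := eqVneq (B r r) 0.
  have rz := B0 _ lr r0; exists u1; first exact: sub.
  move=> v [c [y sy ->]]; apply: u1E; apply: lD => //.
  by rewrite eE rz addr0.
(* As r is orthogonal to the span of s, the correction leaves the values there unchanged, and its
   coefficient makes the value at r equal to F r. *)
exists (u1 + ((F r) / B r r) *: r); first by apply: lD' => //; exact: sub.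
move=> v [c [y sy ->]].
have sy' : lspan s (y + c *: p) by exact: lD.
have -> : y + c *: e = (y + c *: p) + c *: r by rewrite [in LHS]eE scalerDr addrA.
have lu : lspan (e :: s) (u1 + (F r / B r r) *: r) by apply: lD' => //; exact: sub.
have s1 := sub _ su1; have sy1 := sub _ sy'.
have E1 : B (u1 + (F r / B r r) *: r) (y + c *: p) = F (y + c *: p).
  by rewrite (Bl _ _ _ _ s1 lr sy1) (rE _ sy') (u1E _ sy') mulr0 addr0.
have E2 : B (u1 + (F r / B r r) *: r) r = F r.
  by rewrite (Bl _ _ _ _ s1 lr lr) (BC u1) (rE _ su1) add0r divfK.
by rewrite BC (Bl _ _ _ _ sy1 lr lu) (Fl _ _ _ sy1 lr) -E1 -[X in _ = _ + c * X]E2 !(BC _ (u1 + _)).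
Qed.

(* The matrices of [rho] and of a right inverse of [rho] in [e] and [d] are square,
   hence inverse to each other on both sides. *)
Lemma dim_injective n (e d : 'I_n -> E) (rho : E -> E) (W V : set E) :
  (forall u v c, rho (u + c *: v) = rho u + c *: rho v) -> rho 0 = 0 ->
  W = [set v | exists l : 'I_n -> R, v = \sum_i l i *: e i] ->
  (forall l : 'I_n -> R, \sum_i l i *: d i = 0 -> forall i, l i = 0) ->
  V = [set v | exists l : 'I_n -> R, v = \sum_i l i *: d i] ->
  (forall v, W v -> V (rho v)) -> (forall u, V u -> exists2 v, W v & rho v = u) ->
  forall v, W v -> rho v = 0 -> v = 0.
Proof.
move=> rhoD rho0 WE dfree VE rhoV rhoW.
have rho_sum (l : 'I_n -> R) (f : 'I_n -> E) : rho (\sum_i l i *: f i) = \sum_i l i *: rho (f i).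
  have rhoA : {morph rho : x y / x + y} by move=> x y; rewrite -[y in LHS]scale1r rhoD scale1r.
  rewrite (big_morph rho rhoA rho0); apply: eq_bigr => i _.
  by rewrite -[l i *: f i]add0r rhoD rho0 add0r.
have We i : W (e i).
  rewrite WE; exists (fun j => (j == i)%:R).
  by rewrite (bigD1 i)//= eqxx scale1r big1 ?addr0// => j /negbTE ->; rewrite scale0r.
have Vd i : V (d i).
  rewrite VE; exists (fun j => (j == i)%:R).
  by rewrite (bigD1 i)//= eqxx scale1r big1 ?addr0// => j /negbTE ->; rewrite scale0r.
have /choice[M hM] : forall j, exists m : 'I_n -> R, rho (e j) = \sum_i m i *: d i.
  by move=> j; have := rhoV _ (We j); rewrite VE.
have /choice[K hK] : forall i, exists m : 'I_n -> R, d i = \sum_j m j *: rho (e j).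
  move=> i; have [w + wd] := rhoW _ (Vd i); rewrite WE => -[m wE].
  by exists m; rewrite -wd wE rho_sum.
pose MM : 'M[R]_n := \matrix_(j, i) M j i; pose KM : 'M[R]_n := \matrix_(i, j) K i j.
have KM1 : KM *m MM = 1%:M.
  apply/matrixP => i l; apply/eqP; rewrite -subr_eq0; apply/eqP.
  have /(_ _ l) := dfree (fun l => (KM *m MM) i l - (1%:M : 'M[R]_n) i l).
  apply; under eq_bigr do rewrite scalerBl.
  rewrite big_split/= sumrN; apply/eqP; rewrite subr_eq0; apply/eqP.
  transitivity (d i).
    rewrite [RHS]hK; under [RHS]eq_bigr do rewrite hM scaler_sumr.
    rewrite exchange_big/=; apply: eq_bigr => j _; rewrite !mxE scaler_suml.
    by apply: eq_bigr => m _; rewrite !mxE scalerA.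
  rewrite (bigD1 i)//= mxE eqxx scale1r big1 ?addr0// => j /negbTE ji.
  by rewrite mxE eq_sym ji scale0r.
have MK1 := mulmx1C KM1.
move=> v + v0; rewrite WE => -[l vE].
pose L : 'rV[R]_n := \row_j l j.
have LM : L *m MM = 0.
  apply/matrixP => a i; rewrite ord1 [RHS]mxE.
  apply: (dfree (fun i => (L *m MM) 0 i)).
  transitivity (rho v); last exact: v0.
  rewrite vE rho_sum; under [RHS]eq_bigr do rewrite hM scaler_sumr.
  rewrite exchange_big/=; apply: eq_bigr => j _; rewrite !mxE scaler_suml.
  by apply: eq_bigr => m _; rewrite !mxE scalerA.
have L0 : L = 0 by rewrite -[L]mulmx1 -MK1 mulmxA LM mul0mx.
rewrite vE big1// => j _; have := congr1 (fun A : 'rV[R]_n => A 0 j) L0.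
by rewrite !mxE => ->; rewrite scale0r.
Qed.

End linear_algebra.

(** * Surface gradients of finite element functions *)

Section W_h_gradients.
Context {R : realType}.
Variables (k N : nat) (T : 'I_N -> 'I_4 -> R3 R) (S : {set 'I_N}).
Variables (Gamma : set (R3 R)) (sigma : {measure set (R3 R) -> \bar R}).
Hypothesis cG : compact Gamma.
Hypothesis sG : smooth_surface Gamma.
Hypothesis hsigma : surface_measure Gamma sigma.
Hypothesis GO : Gamma `<=` omega_h T S.

(** Off the union of the coincidence sets of all pairs of pieces, the gradient of u at a point is
    that of any piece through it; measurability and bounds are then inherited from the continuous
    gradients of finitely many pieces. *)
Lemma W_h_regular u : W_h k T S u -> regular Gamma sigma u.
Proof.
move=> Wu; have [P [C1P uP]] := W_h_pieces Wu.
have mG : measurable Gamma := Gamma_measurable cG.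
pose Zij (ij : 'I_N * 'I_N) := [set x | [/\ Gamma x, P ij.1 x = P ij.2 x &
    surface_grad Gamma (P ij.1) x <> surface_grad Gamma (P ij.2) x]].
have hZ ij : measurable (Zij ij) /\ sigma (Zij ij) = 0%E.
  exact: (coincidence_null cG sG hsigma (C1P ij.1) (C1P ij.2)).
pose Z := \bigcup_ij Zij ij.
have mZ : measurable Z.
  apply: fin_bigcup_measurable => [|ij _]; first exact: finite_finset.
  by have [] := hZ ij.
have Z0 : sigma Z = 0%E by exact: (bigcup_null hZ mZ).
(* Indices outside S get the empty cell, so that the cover is indexed by all elements. *)
pose F i : set (R3 R) := [set x | i \in S /\ tetrahedron (T i) x].
have cF i : closed (F i).
  rewrite /F; have [iS|niS] := boolP (i \in S).
    by rewrite (_ : [set _ | _] = tetrahedron (T i)); [exact: tetrahedron_closed|apply/seteqP; split=> x //= []].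
  by rewrite (_ : [set _ | _] = set0); [exact: closed0|apply/seteqP; split=> x //= []].
have GF x : Gamma x -> exists i, F i x by move=> /GO[i iS Tx]; exists i.
have uF i x : F i x -> Gamma x -> u x = P i x by move=> [iS Tx] _; exact: uP.
have gu x i : (Gamma `\` Z) x -> F i x ->
    is_surface_grad Gamma u x (surface_grad Gamma (P i) x).
  move=> [Gx nZ]; apply: (piecewise_surface_grad sG cF GF C1P uF Gx) => {}i j Fi Fj.
  apply: contrapT => ne; apply: nZ; exists (i, j) => //.
  by split=> //=; rewrite -(uF i)// -(uF j).
have cgrad i : {within Gamma, continuous (surface_grad Gamma (P i))}.
  exact: surface_grad_continuous.
exists Z; split=> //; split.
- move=> x Gx nZ; have [i Fx] := GF _ Gx.
  by have h := gu x i (conj Gx nZ) Fx; rewrite (surface_gradE h).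
- move=> c; apply: (@measurable_fun_fin_cover _ _ _ _ _ F _
    (fun i x => coordL c (surface_grad Gamma (P i) x))).
  + by move=> i; exact: closed_measurable3.
  + by move=> x [Gx _]; exact: GF.
  + by move=> i x Gx Fx; rewrite (surface_gradE (gu x i Gx Fx)).
  + move=> i; apply: (measurable_funS mG); first by move=> x [].
    apply: within_measurable3 => // x.
    exact: (cvg_comp _ _ (cgrad i x) (@coord_continuous R c _)).
- have /choice[M hM] : forall i, exists M : R, forall x, Gamma x -> `|surface_grad Gamma (P i) x| <= M.
    move=> i; have [] := @compact_fun_bounded R Gamma (fun x => `|surface_grad Gamma (P i) x|) cG.
      by move=> x; exact: (cvg_norm (cgrad i x)).
    by move=> M hM; exists M => x /hM; rewrite normr_id.
  exists (\sum_i `|M i|) => x Gx; have [i Fx] := GF _ (proj1 Gx).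
  rewrite (surface_gradE (gu x i Gx Fx)) (bigD1 i)//= ler_wpDr// ?sumr_ge0//.
  by apply: (le_trans (hM i x (proj1 Gx))); exact: ler_norm.
Qed.

End W_h_gradients.

Lemma lebesgue3_omega_fin (R : realType) N (T : 'I_N -> 'I_4 -> R3 R) (S : {set 'I_N}) :
  (lebesgue3 (omega_h T S) < +oo)%E.
Proof.
have /choice[M hM] : forall i, exists M : R, forall x, tetrahedron (T i) x -> `|x| <= M.
  move=> i; have [] := @compact_fun_bounded R _ (fun x => `|x|) (@tetrahedron_compact R (T i)).
    by apply: continuous_subspaceT; exact: norm_continuous.
  by move=> M hM; exists M => x /hM; rewrite normr_id.
pose L := \sum_i `|M i|.
pose J : set R := `[- L, L]%classic.
have mJ : measurable J by exact: measurable_itv.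
have E : lebesgue3 (J `*` J `*` J) =
    (@lebesgue_measure R J * @lebesgue_measure R J * @lebesgue_measure R J)%E.
  transitivity (lebesgue2 (J `*` J) * @lebesgue_measure R J)%E.
    by apply: product_measure1E => //; exact: measurableX.
  by congr (_ * _)%E; exact: product_measure1E.
apply: (@le_lt_trans _ _ (lebesgue3 (J `*` J `*` J))).
  apply: le_measure; rewrite ?inE.
  - by apply: closed_measurable3; exact: omega_h_closed.
  - by do 2?apply: measurableX.
  move=> x [i iS Tx].
  have : `|x| <= L.
    apply: (le_trans (hM i x Tx)); rewrite /L (bigD1 i)//= ler_wpDr ?sumr_ge0//.
    exact: ler_norm.
  by rewrite norm3_le /J /= !in_itv/= -!ler_norml => /and3P[-> -> ->].
rewrite E; have [r ->] : exists r : R, lebesgue_measure J = r%:E.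
  by rewrite /J lebesgue_measure_itv/=; case: ifP => _; [rewrite -EFinB|]; eexists.
by rewrite -!EFinM ltry.
Qed.

Section restriction.
Context {R : realType}.
Variables (Gamma : set (R3 R)) (sigma : {measure set (R3 R) -> \bar R}).

Lemma patchD (u v : R3 R -> R) c : (u + c *: v) \_ Gamma = u \_ Gamma + c *: (v \_ Gamma).
Proof.
apply: funext => x; rewrite !fctE !patchE; case: ifP => // _.
by rewrite scaler0 addr0.
Qed.

Lemma patch_in (u : R3 R -> R) x : Gamma x -> (u \_ Gamma) x = u x.
Proof. by move=> Gx; rewrite patchE mem_set. Qed.

(** Extension by zero destroys smoothness in space but keeps the trace on Gamma, which determines
    the surface gradient; hence the form takes the same values on W_h and on V_h. *)
Lemma bilin_a_patch u v :
  bilin_a Gamma sigma (u \_ Gamma) (v \_ Gamma) = bilin_a Gamma sigma u v.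
Proof.
apply: eq_Rintegral => x _.
have E w : surface_grad Gamma (w \_ Gamma) x = surface_grad Gamma w x.
  by apply: surface_grad_ext => y Gy; rewrite patch_in.
by rewrite !E.
Qed.

Lemma bilin_l2_patch u v :
  bilin_l2 Gamma sigma (u \_ Gamma) (v \_ Gamma) = bilin_l2 Gamma sigma u v.
Proof. by apply: eq_Rintegral => x /set_mem Gx; rewrite !patch_in. Qed.

Lemma bilin_a0l (u v : R3 R -> R) : smooth_surface Gamma ->
  (forall x, Gamma x -> u x = 0) -> bilin_a Gamma sigma u v = 0.
Proof.
move=> sG u0; rewrite /bilin_a /Rintegral integral0_eq//= => x _.
by rewrite (surface_grad0 sG x u0) dot0l.
Qed.

End restriction.

(** * Unique solvability and equality of the eigenvalues *)

Theorem proposition3p1 (R : realType) (Omega Gamma : set (R3 R))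
    (sigma : {measure set (R3 R) -> \bar R}) (kappa : R) (N : nat)
    (T : 'I_N -> 'I_4 -> R3 R) (S : {set 'I_N}) (k : nat)
    (hOmega : domain Omega) (bOmega : bounded_set Omega)
    (hGamma : closed_connected_smooth_surface Gamma)
    (sGamma : Gamma `<=` Omega)
    (hsigma : surface_measure Gamma sigma)
    (hT : tetrahedral_partition Omega T)
    (hkappa : shape_regular kappa T)
    (hS : cut_mesh Gamma sigma T S)
    (hk : (1 <= k)%N) :
  let omega := omega_h T S in
  let W := W_h k T S in
  let V := V_h Gamma k T S in
  let a := bilin_a Gamma sigma in
  let l2 := bilin_l2 Gamma sigma in
  (* the four mutually equivalent conditions *)
  [\/ [set w | W w /\ forall v, W v -> a w v = 0]
        = [set w | exists c : R, w = c *: \1_omega],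
      forall v, W v -> (forall x, Gamma x -> v x = 0) -> v = 0,
      forall v, W v -> v <> 0 -> ~ (Gamma `<=` [set x | omega x /\ v x = 0]) |
      exists n, has_dim W n /\ has_dim V n] ->
  (forall (c : R) (f : R3 R -> R), 0 < c -> f \in Lfun sigma 2%:E ->
     exists! u : R3 R -> R,
       W u /\ forall v, W v -> a u v + l2 (c *: u) v = l2 f v) /\
  [set lambda : R | exists u : R3 R -> R,
     [/\ V u, ('N[sigma]_(2%:E)[EFin \o u] = 1)%E &
         forall v, V v -> a u v = lambda * l2 u v]]
  = [set lambda : R | exists u : R3 R -> R,
     [/\ W u, ('N[lebesgue3]_(2%:E)[EFin \o u] = 1)%E &
         forall v, W v -> a u v = lambda * l2 u v]].
Proof.
move=> omega W V a l2 cond.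
have [cG _ [x0 Gx0] sG] := hGamma.
have GO : Gamma `<=` omega := Gamma_sub_omega_h cG sG hsigma sGamma hT hS.
have mG : measurable Gamma := Gamma_measurable cG.
have inj : forall v, W v -> (forall x, Gamma x -> v x = 0) -> v = 0.
  case: cond => [kerE|//|h|[n [[e [_ WE]] [d [dfree VE]]]]] v Wv v0.
  (* A function with zero trace lies in the kernel of a, hence is a multiple of the indicator of
     omega_h; its value at the point x0 of Gamma shows that the multiple is zero. *)
  - have : [set w | W w /\ forall v, W v -> a w v = 0] v.
      by split=> // w _; exact: bilin_a0l.
    rewrite kerE => -[c vE].
    have c0 : c = 0 by rewrite -(v0 _ Gx0) vE !fctE indicE mem_set ?[RHS]mulr1//; exact: GO.
    by rewrite vE c0 scale0r.
  - apply: contrapT => vn0; apply: (h v Wv vn0) => x Gx; split; [exact: GO|exact: v0].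
  (* By definition of V_h the restriction is onto, and here it acts between spaces of equal finite
     dimension. *)
  - apply: (@dim_injective R _ n e d (fun v => v \_ Gamma) W V _ _ WE dfree VE) => //.
    + by move=> u w c; exact: patchD.
    + by apply: funext => x; rewrite patchE; case: ifP.
    + by move=> w Ww; exists w.
    + by apply: funext => x; rewrite patchE; case: ifP => // /set_mem/v0.
have reg u : W u -> regular Gamma sigma u by exact: W_h_regular.
have bm u : W u -> bounded_measurable u.
  move=> Wu; split; first exact: W_h_measurable Wu.
  by have [M _ hM] := W_h_bounded Wu; exists M.
have cW u : W u -> {within Gamma, continuous u}.
  by move=> [cu _ _]; exact: continuous_subspaceW cu.
have aD u v w c : W u -> W v -> W w -> a (u + c *: v) w = a u w + c * a v w.
  by move=> Wu Wv Ww; apply: bilin_aDl => //; exact: reg.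
have l2D u v w c : W u -> W v -> W w -> l2 (u + c *: v) w = l2 u w + c * l2 v w.
  move=> Wu Wv Ww; rewrite /l2 !(bilin_l2C _ _ _ w); apply: bilin_l2Dr => //; try exact: bm.
  by apply: bounded_measurable_integrable => //; exact: bm.
have W0 : W 0 by exact: W_h0.
have WD (u v : R3 R -> R) (c : R) : W u -> W v -> W (u + c *: v) by exact: W_hD.
have WZ (u : R3 R -> R) (c : R) : W u -> W (c *: u) by exact: W_hZ.
have a0 v : a 0 v = 0 by exact: bilin_a0l.
have l20 v : l2 0 v = 0.
  by rewrite /l2 /bilin_l2 /Rintegral integral0_eq//= => x _; exact: (congr1 EFin (mul0r (v x))).
have aZ c u v : W u -> W v -> a (c *: u) v = c * a u v.
  by move=> Wu Wv; rewrite -[c *: u]add0r aD// a0 add0r.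
have l2Z c u v : W u -> W v -> l2 (c *: u) v = c * l2 u v.
  by move=> Wu Wv; rewrite -[c *: u]add0r l2D// l20 add0r.
have l2_eq0 u : W u -> l2 u u = 0 -> u = 0.
  move=> Wu u0; apply: inj => // x Gx.
  exact: (bilin_l2_eq0 cG sG hsigma (bm _ Wu) (cW _ Wu) u0).
have [s WE] : exists s, W = lspan s.
  apply: (@linear_subset_lspan R _ [seq local_monomial T S i | i <- index_enum _]) => //.
  by move=> v /W_h_span[c ->]; exact: lspan_sum.
split.
  move=> c f c0 fL; have fi := Lfun2_integrable_Gamma cG sG hsigma fL.
  pose B (u v : R3 R -> R) := a u v + c * l2 u v.
  have BD u v w t : W u -> W v -> W w -> B (u + t *: v) w = B u w + t * B v w.
    move=> Wu Wv Ww; rewrite /B (aD _ _ _ _ Wu Wv Ww) (l2D _ _ _ _ Wu Wv Ww).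
    by rewrite mulrDr addrACA mulrDr (mulrCA c t).
  have BC u v : B u v = B v u by rewrite /B /a bilin_aC /l2 bilin_l2C.
  have B0 u : W u -> B u u = 0 -> u = 0.
    move=> Wu /eqP; rewrite paddr_eq0 ?mulr_ge0 ?bilin_a_ge0 ?bilin_l2_ge0 ?(ltW c0)//.
    by rewrite mulf_eq0 (gt_eqF c0)/= => /andP[_ /eqP]; exact: l2_eq0.
  have [| | |u] := @riesz_lspan R _ B s _ BC _ (l2 f).
  - by rewrite -WE.
  - by rewrite -WE.
  - by rewrite -WE => u v t Wu Wv; apply: bilin_l2Dr => //; exact: bm.
  rewrite -WE => Wu uE; exists u; split.
    by split=> // v Wv; rewrite l2Z//; exact: uE.
  move=> w [Ww wE].
  (* The difference of two solutions, tested against itself, has zero energy. *)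
  have Wuw : W (u + (-1) *: w) by exact: WD.
  have := B0 _ Wuw; rewrite BD// (uE _ Wuw).
  have -> : B w (u + (-1) *: w) = l2 f (u + (-1) *: w) by rewrite /B -l2Z//; exact: wE.
  rewrite mulN1r subrr => /(_ erefl)/eqP; rewrite scaleN1r subr_eq0 => /eqP ->.
  by [].
apply/seteqP; split=> lambda.
  (* From V_h to W_h: w has a nonzero trace, so it is nonzero, hence nonzero on an open set, and can
     be rescaled to norm 1 in omega_h. *)
  move=> [_ [[w Ww <-] n1 hw]].
  have wn0 : w <> 0.
    move=> w0; move: n1; rewrite w0.
    rewrite (_ : EFin \o _ = cst 0%E) ?Lnorm0// => [/eqP|]; first by rewrite eq_sym onee_eq0.
    by apply: funext => x /=; rewrite patchE; case: ifP.
  have [M M0 hM] := W_h_bounded Ww.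
  have [Q [oQ Q0 hQ]] := W_h_neq0_open hkappa Ww wn0.
  have [| | | | |c c0 Nc] := @Lnorm2_normalize _ _ _ lebesgue3 omega w M _ (lebesgue3_omega_fin T S).
  - by apply: closed_measurable3; exact: omega_h_closed.
  - exact: W_h_measurable Ww.
  - exact: hM.
  - by case: Ww.
  - move=> [B [mB B0 hB]]; have := lebesgue3_open_gt0 oQ Q0.
    rewrite lt0e => /andP[/eqP + _]; apply.
    apply: (subset_measure0 _ mB _ B0); first exact: open_measurable3.
    by move=> y Qy; apply: hB; exact: hQ.
  exists (c *: w); split=> //; first exact: WZ.
  move=> v Wv; rewrite aZ// l2Z// mulrCA; congr (_ * _).
  have Vv : V (v \_ Gamma) by exists v.
  have := hw _ Vv; rewrite /a bilin_a_patch => ->.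
  by rewrite /l2 bilin_l2_patch.
(* From W_h to V_h: injectivity provides a point of Gamma with w nonzero, by continuity a relatively
   open set of such points, and this set has positive surface measure. *)
move=> [w [Ww n1 hw]].
have wn0 : w <> 0.
  move=> w0; move: n1; rewrite w0.
  rewrite (_ : EFin \o _ = cst 0%E) ?Lnorm0// => /eqP; by rewrite eq_sym onee_eq0.
have [x Gx wx] : exists2 x, Gamma x & w x != 0.
  apply: contrapT => h; apply: wn0; apply: inj => // x Gx; apply/eqP/negPn/negP => wx.
  by apply: h; exists x.
have [M M0 hM] := W_h_bounded Ww.
have [| | | |c c0 Nc] := @Lnorm2_normalize _ _ _ sigma setT (w \_ Gamma) M measurableT
  (sigmaT_fin cG sG hsigma).
- apply/(measurable_restrictT _ mG).
  by apply: measurable_funTS; exact: W_h_measurable Ww.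
- by move=> y; rewrite patchE; case: ifP => // _; rewrite normr0.
- by move=> y /(_ I).
- move=> [B [mB B0 hB]].
  have [Q oQ QE] := within_preimage_open (cW _ Ww) (@open_neq R 0).
  have Qx : (Gamma `&` Q) x by rewrite -QE.
  have := sigma_open_gt0 cG sG hsigma oQ (proj2 Qx) Gx.
  rewrite lt0e => /andP[/eqP + _]; apply.
  apply: (subset_measure0 _ mB _ B0).
    by apply: measurableI => //; exact: open_measurable3.
  rewrite -QE => y [Gy wy]; apply: hB; rewrite /= patch_in//.
exists (c *: (w \_ Gamma)).
have cE : c *: (w \_ Gamma) = (c *: w) \_ Gamma.
  by apply: funext => y; rewrite !fctE !patchE; case: ifP => // _; rewrite scaler0.
split=> //; first by exists (c *: w); [exact: WZ|rewrite cE].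
move=> _ [v Wv <-]; rewrite cE /a bilin_a_patch /l2 bilin_l2_patch.
rewrite -/a -/l2 aZ// l2Z// mulrCA; congr (_ * _); exact: hw.
Qed.
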